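(* Let $R$ be an exceptional prime ring with extended centroid $C$. Let $\delta,d$ be nonzero derivations of $R$, and let $L$ be a noncentral abelian Lie ideal of $R$. (i) If $d$ is X-inner and $\delta$ is X-outer, then $\delta d(L)\subseteq Z(R)$ if and only if $d([R,R])\subseteq Z(R)$. (ii) If both $d$ and $\delta$ are X-inner, then $\delta d(L)\subseteq Z(R)$ if and only if either $d([R,R])\subseteq Z(R)$ or $\delta([R,R])\subseteq Z(R)$. (iii) If $d$ is X-outer and $\delta$ is X-inner, then $\delta d(L)\subseteq Z(R)$ if and only if $\delta([R,R])\subseteq Z(R)$. (iv) If both $\delta$ and $d$ are X-outer, then $\delta d(L)\subseteq Z(R)$ if and only if there exists $\beta\in Z(R)$ such that neither $d(\beta)=0$ nor $\delta(\beta)=0$, and there exist $g\in RC$, $\mu\in C$, and $h\in[RC,RC]$ such that $$\delta(\beta)d+d(\beta)\delta=\mathrm{ad}_g,\quad d^2=\mu d+\mathrm{ad}_h\quad\text{and}\quad \delta(\beta)\mu z+[g,z]\in C\ \ \forall z\in LC,$$ and, moreover, if neither $d(LC)\subseteq LC$ nor $g\in[RC,RC]$, then $g^2+\delta(\beta)\mu g\in LC$.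
   Context: Rings are associative, not necessarily unital; $Z(R)$ is the center of $R$. $[a,b]:=ab-ba$; for additive subgroups $A,B$ of a ring, $AB$ (resp. $[A,B]$) is the additive subgroup generated by all $ab$ (resp. $[a,b]$), $a\in A$, $b\in B$. A Lie ideal of $R$ is an additive subgroup $L$ with $[L,R]\subseteq L$; it is abelian if $[L,L]=0$ and noncentral if $L\not\subseteq Z(R)$. For a prime ring $R$, let $Q_s(R)$ be its Martindale symmetric ring of quotients and $C$ (the extended centroid) the center of $Q_s(R)$, which is a field; products such as $RC$, $LC$ are taken in $Q_s(R)$. A prime ring $R$ is called exceptional if both $\mathrm{char}\,R=2$ and $\dim_C RC=4$; in this case $RC$ is a central simple $C$-algebra (with $1$, so $C\subseteq RC$). A derivation of $R$ is an additive map $d\colon R\to R$ with $d(xy)=xd(y)+d(x)y$. Every derivation $d$ of $R$ extends uniquely to a derivation, also denoted $d$, of $Q_s(R)$, with $d(C)\subseteq C$ and $d(RC)\subseteq RC$. $\mathrm{ad}_a$ denotes the map $x\mapsto[a,x]$. A derivation $d$ of $R$ is X-inner if its extension to $Q_s(R)$ equals $\mathrm{ad}_a$ for some $a\in Q_s(R)$ (for exceptional $R$, $Q_s(R)=RC$), and X-outer otherwise. $\delta d$ and $d^2$ are compositions; identities between derivations are identities of maps on $RC$. *)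

(* Defs.v *)
From HB Require Import structures.
From mathcomp Require Import all_boot all_order all_algebra.
From mathcomp Require Import boolp classical_sets.

Set Implicit Arguments.
Unset Strict Implicit.
Unset Printing Implicit Defensive.

Import GRing.Theory.
Local Open Scope ring_scope.
Local Open Scope classical_set_scope.

(* Associative rings, not necessarily unital. *)
HB.mixin Record Zmodule_isRng R of GRing.Zmodule R := {
  rmul : R -> R -> R;
  rmulA : associative rmul;
  rmulDl : left_distributive rmul +%R;
  rmulDr : right_distributive rmul +%R
}.

#[short(type="rngType")]
HB.structure Definition Rng := { R of Zmodule_isRng R & GRing.Zmodule R }.

Notation "x ** y" := (rmul x y) (at level 40, left associativity) : ring_scope.

(* Forgetting the unit; on a unital ring [**] is convertible to [*]. *)
#[non_forgetful_inheritance]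
HB.instance Definition _ (Q : nzRingType) :=
  Zmodule_isRng.Build Q (@mulrA Q) (@mulrDl Q) (@mulrDr Q).

Section Rings.
Variable R : rngType.
Implicit Types (a b x y : R) (A B I L : set R) (d : R -> R).

Definition ad a x : R := a ** x - x ** a.

Definition add_subgroup A : Prop :=
  A 0 /\ forall x y, A x -> A y -> A (x - y).

Definition prodset A B : set R :=
  smallest add_subgroup [set a ** b | a in A & b in B].

Definition commset A B : set R :=
  smallest add_subgroup [set ad a b | a in A & b in B].

Definition rng_center : set R := [set z | forall x, z ** x = x ** z].

Definition lie_ideal L : Prop := add_subgroup L /\ commset L setT `<=` L.

Definition lie_abelian L : Prop := commset L L = [set 0].

Definition noncentral L : Prop := ~ (L `<=` rng_center).

Definition rng_ideal I : Prop :=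
  add_subgroup I /\ forall x a, I a -> I (x ** a) /\ I (a ** x).

Definition prime_rng : Prop :=
  (exists x, x <> 0) /\
  forall a b, (forall x, a ** x ** b = 0) -> a = 0 \/ b = 0.

Definition derivation d : Prop :=
  (forall x y, d (x + y) = d x + d y) /\
  (forall x y, d (x ** y) = x ** d y + d x ** y).

End Rings.

Arguments rng_center : clear implicits.
Arguments prime_rng : clear implicits.

Section SymmetricQuotients.
Variables (R : rngType) (Q : nzRingType) (iota : {additive R -> Q}).

(* [Q], with the embedding [iota], is the Martindale symmetric ring of
   quotients of the prime ring [R]: the four properties that determine it up to
   a unique isomorphism over [R] (Beidar, Martindale and Mikhalev, "Rings with
   generalized identities", Section 2.2). In the last one, [f] and [g] matter
   only on [I], where they are a right and a left [R]-module map. *)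
Record symmetric_quotients : Prop := {
  sqM : forall x y, iota (x ** y) = iota x * iota y;
  sq_inj : injective iota;
  sq_denom : forall q : Q, exists I : set R,
    [/\ rng_ideal I, I <> [set 0] &
        forall x, I x -> range iota (q * iota x) /\ range iota (iota x * q)];
  sq_faithful : forall (q : Q) (I : set R), rng_ideal I -> I <> [set 0] ->
    (forall x, I x -> q * iota x = 0) \/ (forall x, I x -> iota x * q = 0) ->
    q = 0;
  sq_complete : forall (I : set R) (f g : R -> R),
    rng_ideal I -> I <> [set 0] ->
    (forall x y, I x -> I y -> f (x + y) = f x + f y) ->
    (forall x r, I x -> f (x ** r) = f x ** r) ->
    (forall x y, I x -> I y -> g (x + y) = g x + g y) ->
    (forall x r, I x -> g (r ** x) = r ** g x) ->
    (forall x y, I x -> I y -> x ** f y = g x ** y) ->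
    exists q : Q, forall x, I x ->
      q * iota x = iota (f x) /\ iota x * q = iota (g x)
}.

Definition ext_centroid : set Q := rng_center Q.

(* The central closure [RC]. *)
Definition central_closure : set Q := prodset (range iota) ext_centroid.

(* The [C]-span [LC]. *)
Definition cspan (L : set R) : set Q := prodset (iota @` L) ext_centroid.

(* [V] has a basis of [n] elements over [C]; [C] is a field, but only as a
   subset of [Q], so the dimension theory of the library does not apply. *)
Definition ext_dim (V : set Q) (n : nat) : Prop :=
  exists e : 'I_n -> Q,
    [/\ forall i, V (e i),
        forall c : 'I_n -> Q, (forall i, ext_centroid (c i)) ->
          \sum_i c i * e i = 0 -> forall i, c i = 0 &
        forall v, V v -> exists c : 'I_n -> Q,
          (forall i, ext_centroid (c i)) /\ v = \sum_i c i * e i].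

(* For a prime (hence nonzero) ring, [2 R = 0] says that [char R = 2]. *)
Definition exceptional : Prop :=
  (forall x : R, x *+ 2 = 0) /\ ext_dim central_closure 4.

Definition der_extension (d : R -> R) (D : Q -> Q) : Prop :=
  derivation D /\ forall x, D (iota x) = iota (d x).

Definition X_inner (d : R -> R) : Prop :=
  exists a : Q, der_extension d (ad a).

Definition X_outer (d : R -> R) : Prop := ~ X_inner d.

End SymmetricQuotients.

Arguments ext_centroid : clear implicits.

(* A derivation of [R] has exactly one extension to [Q], so a hypothesis
   [der_extension iota d D] only names that extension. *)
Section Extension.
Variables (R : rngType) (Q : nzRingType) (iota : {additive R -> Q}).
Hypotheses (R_prime : prime_rng R) (Q_sym : symmetric_quotients iota).

Let iM : forall x y, iota (x ** y) = iota x * iota y := sqM Q_sym.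

Lemma der_extension_unique d D1 D2 :
  der_extension iota d D1 -> der_extension iota d D2 -> D1 = D2.
Proof.
move=> [[D1D D1M] D1i] [[D2D D2M] D2i]; apply/funext => q.
have [I [I_id I0 Iq]] := sq_denom Q_sym q.
apply/eqP; rewrite -subr_eq0; apply/eqP.
apply: (sq_faithful Q_sym I_id I0); left => x /Iq [[u _ uE] _].
have /eqP := D1i u; rewrite -(D2i u) uE.
have -> : D1 (q * iota x) = q * D1 (iota x) + D1 q * iota x := D1M q (iota x).
have -> : D2 (q * iota x) = q * D2 (iota x) + D2 q * iota x := D2M q (iota x).
by rewrite D1i D2i -subr_eq0 opprD addrACA subrr add0r -mulrBl => /eqP.
Qed.

Lemma der_extension_exists d :
  derivation d -> exists D, der_extension iota d D.
Proof.
move=> [dD dM].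
have d0 : d 0 = 0 by apply: (addrI (d 0)); rewrite -dD !addr0.
have dB x y : d (x - y) = d x - d y.
  by apply/eqP; rewrite eq_sym subr_eq -dD subrK.
pose S q q' := forall x u, iota u = q * iota x ->
  iota (d u) = q * iota (d x) + q' * iota x.
have Sex q : exists q', S q q'.
  have [I [[[I0 IB] IM] In0 Iq]] := sq_denom Q_sym q.
  have ID x y : I x -> I y -> I (x + y).
    move=> Ix Iy; rewrite -[y]opprK; apply: (IB) => //.
    by rewrite -sub0r; apply: IB.
  have Il x a : I a -> I (x ** a) by case/(IM x).
  have Ir x a : I a -> I (a ** x) by case/(IM x).
  pose J : set R := [set x | I x /\ I (d x)].
  have J_id : rng_ideal J.
    split; first by split=> [|x y [Ix Idx] [Iy Idy]]; split;
      rewrite ?d0 ?dB //; apply: IB.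
    move=> x a [Ia Ida]; split; split; rewrite ?dM; [exact: Il | | exact: Ir |].
      by apply: ID; apply: Il.
    by apply: ID; apply: Ir.
  have J0 : J <> [set 0].
    move=> JE; apply: In0; apply/seteqP; split=> [a Ia|a ->] //=.
    case: (R_prime) => _ /(_ a a); case=> // x.
    suff : J (a ** x ** a) by rewrite JE.
    split; first exact: Il.
    by rewrite dM; apply: ID; [apply/Ir/Ir | apply: Il].
  have /choice [f fE] : forall x, exists y, J x ->
      exists2 u, iota u = q * iota x & iota y = iota (d u) - q * iota (d x).
    move=> x; have [[Ix Idx]|nJ] := pselect (J x); last by exists 0.
    have [[u _ uE] _] := Iq _ Ix; have [[v _ vE] _] := Iq _ Idx.
    by exists (d u - v) => _; exists u; rewrite // raddfB vE.
  have /choice [g gE] : forall x, exists y, J x ->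
      exists2 u, iota u = iota x * q & iota y = iota (d u) - iota (d x) * q.
    move=> x; have [[Ix Idx]|nJ] := pselect (J x); last by exists 0.
    have [_ [u _ uE]] := Iq _ Ix; have [_ [v _ vE]] := Iq _ Idx.
    by exists (d u - v) => _; exists u; rewrite // raddfB vE.
  have inj := sq_inj Q_sym.
  have JD x y : J x -> J y -> J (x + y).
    by move=> [? ?] [? ?]; split; rewrite ?dD; apply: ID.
  have fP x u : J x -> iota u = q * iota x ->
      iota (f x) = iota (d u) - q * iota (d x).
    by move=> /fE[v vE ->]; rewrite -vE => /inj ->.
  have gP x u : J x -> iota u = iota x * q ->
      iota (g x) = iota (d u) - iota (d x) * q.
    by move=> /gE[v vE ->]; rewrite -vE => /inj ->.
  case: (sq_complete Q_sym (I := J) (f := f) (g := g)) => //.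
  - move=> x y Jx Jy; apply: (inj); rewrite raddfD /=.
    have [u uE ->] := fE x Jx; have [v vE ->] := fE y Jy.
    rewrite (fP _ (u + v)); first by rewrite !dD !raddfD /= mulrDr opprD addrACA.
      exact: JD.
    by rewrite !raddfD /= mulrDr uE vE.
  - move=> x r Jx; apply: (inj); rewrite iM.
    have [u uE ->] := fE x Jx.
    rewrite (fP _ (u ** r)); last by rewrite !iM uE mulrA.
      rewrite !dM !raddfD /= !iM mulrBl mulrDr opprD !mulrA uE addrACA subrr.
      by rewrite add0r.
    by have [_ /(_ r x Jx) []] := J_id.
  - move=> x y Jx Jy; apply: (inj); rewrite raddfD /=.
    have [u uE ->] := gE x Jx; have [v vE ->] := gE y Jy.
    rewrite (gP _ (u + v)); first by rewrite !dD !raddfD /= mulrDl opprD addrACA.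
      exact: JD.
    by rewrite !raddfD /= mulrDl uE vE.
  - move=> x r Jx; apply: (inj); rewrite iM.
    have [u uE ->] := gE x Jx.
    rewrite (gP _ (r ** u)); last by rewrite !iM uE mulrA.
      rewrite !dM !raddfD /= !iM mulrBr mulrDl opprD uE !mulrA.
      by rewrite addrACA subrr addr0.
    by have [_ /(_ r x Jx) []] := J_id.
  - move=> x y Jx Jy; apply: (inj); rewrite !iM.
    have [u uE ->] := gE x Jx; have [v vE ->] := fE y Jy.
    have uv : u ** y = x ** v by apply: (inj); rewrite !iM uE vE mulrA.
    have := congr1 (iota \o d) uv; rewrite /= !dM !raddfD /= !iM uE vE => e.
    rewrite mulrBr mulrBl !mulrA; apply/eqP; rewrite subr_eq addrAC eq_sym subr_eq.
    by rewrite addrC e !mulrA.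
  move=> q' q'E; exists q' => x u uE.
  apply/eqP; rewrite -subr_eq0; apply/eqP.
  apply: (sq_faithful Q_sym J_id J0); left => y Jy.
  have Jxy : J (x ** y) by have [_ /(_ x y Jy) []] := J_id.
  have [+ _] := q'E _ Jxy => /esym; rewrite (fP _ (u ** y)) //; last by rewrite !iM uE mulrA.
  rewrite !dM !raddfD /= !iM uE mulrDr opprD !mulrA addrACA subrr add0r => e.
  by rewrite addrA !mulrBl e subrr.
have /choice [D DS] := Sex; exists D.
have Duniq q1 q2 q3 : S q1 q2 -> S q1 q3 -> q2 = q3.
  move=> S2 S3; have [I [I_id I0 Iq]] := sq_denom Q_sym q1.
  apply/eqP; rewrite -subr_eq0; apply/eqP.
  apply: (sq_faithful Q_sym I_id I0); left => x /Iq [[u _ uE] _].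
  by apply/eqP; rewrite mulrBl subr_eq0 -(inj_eq (addrI (q1 * iota (d x)))) -(S2 _ _ uE) -(S3 _ _ uE).
split; last first.
  by move=> r; apply: Duniq (DS _) _ => x u; rewrite -iM => /(sq_inj Q_sym) ->;
    rewrite dM raddfD /= !iM.
split=> p q.
- apply/eqP; rewrite -subr_eq0; apply/eqP.
  have [I [I_id I0 Ip]] := sq_denom Q_sym p.
  have [J [J_id J0 Jq]] := sq_denom Q_sym q.
  apply: (sq_faithful Q_sym I_id I0); left => x Ix.
  apply: (sq_faithful Q_sym J_id J0); left => y Jy.
  have Ixy : I (x ** y) by have [_ /(_ y x Ix) []] := I_id.
  have Jxy : J (x ** y) by have [_ /(_ x y Jy) []] := J_id.
  have [[u _ uE] _] := Ip _ Ixy; have [[v _ vE] _] := Jq _ Jxy.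
  rewrite -mulrA -iM mulrBl mulrDl.
  have : iota (d (u + v)) = _ := DS (p + q) (x ** y) (u + v) _.
  rewrite raddfD /= mulrDl uE vE => /(_ erefl).
  rewrite dD raddfD /= (DS _ _ _ uE) (DS _ _ _ vE) mulrDl addrACA => /addrI <-.
  by rewrite subrr.
- rewrite [p ** q]/(p * q) [p ** D q]/(p * D q) [D p ** q]/(D p * q).
  apply/eqP; rewrite -subr_eq0; apply/eqP.
  have [I [I_id I0 Ip]] := sq_denom Q_sym p.
  have [J [J_id J0 Jq]] := sq_denom Q_sym q.
  apply: (sq_faithful Q_sym J_id J0); left => x Jx.
  apply: (sq_faithful Q_sym I_id I0); left => y Iy.
  have Jxy : J (x ** y) by have [_ /(_ y x Jx) []] := J_id.
  have [[u _ uE] _] := Jq _ Jx.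
  have Iuy : I (u ** y) by have [_ /(_ u y Iy) []] := I_id.
  have [[v _ vE] _] := Ip _ Iuy.
  have vqE : iota (u ** y) = q * iota (x ** y) by rewrite !iM uE mulrA.
  have vpqE : iota v = (p * q) * iota (x ** y) by rewrite vE vqE mulrA.
  have := DS _ _ _ vpqE; rewrite (DS _ _ _ vE) (DS _ _ _ vqE) vqE => e.
  rewrite -mulrA -iM mulrBl mulrDl -!mulrA.
  move: e; rewrite mulrDr -!mulrA -addrA => /addrI <-.
  by rewrite subrr.
Qed.

End Extension.

(* Main.v *)
(** In characteristic 2 a noncentral [a] in [L] satisfies [[a, [a, x]] = 0], so
    [a ^ 2] is central. Primeness gives a [b] in [RC] with [[a, b] = 1], and
    [dim RC = 4] then forces [RC = K + K b] and [LC = K] for the centralizer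
    [K = C + C a] of [a]. The trace [t] of [x] is read off from
    [[a, x] - t a \in C]. Then [[RC, RC]] is the kernel of the trace,
    [[x, z] - t z \in C] for [z] of trace 0, [x ^ 2 + t x \in C], and every
    derivation of [RC] that kills [C] is inner. As [C] is the field of fractions
    of [Z(R)], X-outer derivations are those moving some element of [Z(R)].

    Comparing [delta d (beta z)] with [beta (delta d z)] for [z] in [[L, R]] gives
    [delta d (beta) z + d (beta) delta z + delta (beta) d z \in C], from which
    each case reduces to a statement about traces. In case (iv),
    [tr g = delta (beta) mu], and the condition that remains is [tr h = 0]; the
    clause on [g ^ 2 + delta (beta) mu g] always holds, by Cayley-Hamilton. *)
Require Import Defs.
From mathcomp Require Import all_boot all_order all_algebra.
From mathcomp Require Import boolp classical_sets.

Set Implicit Arguments.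
Unset Strict Implicit.
Unset Printing Implicit Defensive.

Import GRing.Theory.
Local Open Scope ring_scope.
Local Open Scope classical_set_scope.

(** * Additive subgroups and derivations of a ring that need not be unital *)

Section Rng.
Variable V : rngType.
Implicit Types (x y : V).

Lemma smallest_add_subgroup (G : set V) : add_subgroup (smallest (@add_subgroup V) G).
Proof.
split=> [|x y Mx My] M MP; case: (MP) => -[M0 MB] _ //.
by apply: MB; [apply: Mx | apply: My].
Qed.

Lemma add_subgroupD (P : set V) x y : add_subgroup P -> P x -> P y -> P (x + y).
Proof.
move=> [P0 PB] Px Py; rewrite -[y]opprK; apply: (PB) => //.
by rewrite -sub0r; apply: PB.
Qed.

Lemma derivation0 (D : V -> V) : derivation D -> D 0 = 0.
Proof. by case=> DD _; apply: (addrI (D 0)); rewrite -DD !addr0. Qed.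

Lemma derivation_sub (D : V -> V) x y : derivation D -> D (x - y) = D x - D y.
Proof. by move=> [DD _]; apply/eqP; rewrite eq_sym subr_eq -DD subrK. Qed.

End Rng.

(** * The center of a ring, and linear systems over it when it is a field *)

Section Center.
Variable Q : nzRingType.
Implicit Types (c x y z : Q).
Local Notation C := (rng_center Q).

Lemma centerE c x : C c -> c * x = x * c. Proof. exact. Qed.

Lemma centerI c : (forall x, c * x = x * c) -> C c. Proof. exact. Qed.

Lemma center0 : C 0. Proof. by apply: centerI => x; rewrite mul0r mulr0. Qed.

Lemma center1 : C 1. Proof. by apply: centerI => x; rewrite mul1r mulr1. Qed.

Lemma centerD x y : C x -> C y -> C (x + y).
Proof.
move=> Cx Cy; apply: centerI => z.
by rewrite mulrDl mulrDr (centerE z Cx) (centerE z Cy).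
Qed.

Lemma centerN x : C x -> C (- x).
Proof. by move=> Cx; apply: centerI => z; rewrite mulNr mulrN (centerE z Cx). Qed.

Lemma centerM x y : C x -> C y -> C (x * y).
Proof.
by move=> Cx Cy; apply: centerI => z; rewrite -mulrA (centerE z Cy) mulrA (centerE z Cx) mulrA.
Qed.

Lemma centerCA c x y : C c -> x * (c * y) = c * (x * y).
Proof. by move=> Cc; rewrite !mulrA (centerE x Cc). Qed.

Lemma center_sum n (F : 'I_n -> Q) : (forall i, C (F i)) -> C (\sum_i F i).
Proof. by move=> CF; elim/big_ind: _ => // [|x y]; [apply: center0 | apply: centerD]. Qed.

Hypothesis center_inv : forall c, C c -> c <> 0 -> exists2 c', C c' & c' * c = 1.

Lemma center_mulI c x : C c -> c <> 0 -> c * x = 0 -> x = 0.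
Proof.
by move=> Cc /(center_inv Cc)[k _ k1] cx0; rewrite -[x]mul1r -k1 -mulrA cx0 mulr0.
Qed.

Lemma center_divl c x : C c -> c <> 0 -> C (c * x) -> C x.
Proof.
move=> Cc /(center_inv Cc)[k Ck k1] Ccx.
by rewrite -[x]mul1r -k1 -mulrA; apply: centerM.
Qed.

(** Gaussian elimination by induction on the number of equations: a pivot in the first equation
    removes one equation and one unknown. *)
Lemma center_linear_system n (m : 'I_n.+1 -> 'I_n -> Q) :
  (forall i j, C (m i j)) -> exists c : 'I_n.+1 -> Q,
  [/\ forall i, C (c i), exists i, c i <> 0 & forall j, \sum_i c i * m i j = 0].
Proof.
elim: n m => [|n IH] m mC.
  exists (fun=> 1); split=> [_||[]//]; first exact: center1.
  by exists ord0; apply/eqP; rewrite oner_eq0.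
have [[i0 p0]|np] := pselect (exists i0, m i0 ord0 <> 0).
  have [p Cp p1] := center_inv (mC _ _) p0.
  have [|c [cC [i1 ci1] c0]] := IH (fun i j => m (lift i0 i) (lift ord0 j) -
      m (lift i0 i) ord0 * p * m i0 (lift ord0 j)).
    by move=> i j; apply/centerD/centerN/centerM => //; apply: centerM.
  (* The value of the unknown [i0] forced by the first equation, [p] being the inverse of the
     pivot. *)
  pose k := - \sum_i c i * m (lift i0 i) ord0 * p.
  exists (fun i => if unlift i0 i is Some i' then c i' else k); split.
  - move=> i; case: unliftP => [j _|_] //.
    by apply/centerN/center_sum => j; apply/centerM => //; apply: centerM.
  - by exists (lift i0 i1); rewrite liftK.
  move=> j; rewrite (bigD1_ord i0) //= unlift_none.
  under eq_bigr => i _ do rewrite liftK.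
  rewrite mulNr mulr_suml addrC; apply/eqP; rewrite subr_eq0; apply/eqP.
  case: (unliftP ord0 j) => [j' ->|->]; last first.
    by apply: eq_bigr => i _; rewrite -(mulrA _ p) p1 mulr1.
  apply/eqP; rewrite -subr_eq0 -sumrB -[X in _ == X](c0 j'); apply/eqP.
  by apply: eq_bigr => i _; rewrite mulrBr !mulrA.
(* Without a pivot the first equation is void; it is dropped, and the first unknown is set to 0. *)
have m0 i : m i ord0 = 0 by apply/eqP; apply: contra_notT np => /eqP; exists i.
have [//|c [cC [i1 ci1] c0]] := IH (fun i j => m (lift ord0 i) (lift ord0 j)).
exists (fun i => if unlift ord0 i is Some i' then c i' else 0); split.
- by move=> i; case: unliftP => [j _|_] //; apply: center0.
- by exists (lift ord0 i1); rewrite liftK.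
move=> j; case: (unliftP ord0 j) => [j' ->|->]; last first.
  by rewrite big1 // => i _; rewrite m0 mulr0.
rewrite big_ord_recl unlift_none mul0r add0r -[RHS](c0 j').
by apply: eq_bigr => i _; rewrite liftK.
Qed.

Lemma ext_dim_dependent (V : set Q) n (v : 'I_n.+1 -> Q) :
  ext_dim V n -> (forall i, V (v i)) -> exists c : 'I_n.+1 -> Q,
  [/\ forall i, C (c i), exists i, c i <> 0 & \sum_i c i * v i = 0].
Proof.
move=> [e [_ _ eV]] Vv.
have /choice [m mP] : forall i, exists m : 'I_n -> Q,
    (forall j, C (m j)) /\ v i = \sum_j m j * e j by move=> i; apply: eV.
have [i j|c [cC cn0 c0]] := @center_linear_system n m.
  by case: (mP i) => + _; apply.
exists c; split=> //.
under eq_bigr => i _.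
  rewrite (proj2 (mP i)) mulr_sumr; under eq_bigr => j _ do rewrite mulrA.
  over.
rewrite exchange_big big1 // => j _ /=.
by rewrite -mulr_suml c0 mul0r.
Qed.

End Center.

(** * The commutator as a derivation in each argument, linear over the center *)

Section Commutator.
Variable Q : nzRingType.
Implicit Types (c x y z : Q).
Local Notation C := (rng_center Q).

Lemma adE x y : ad x y = x * y - y * x. Proof. by []. Qed.

Lemma adDl x y z : ad (x + y) z = ad x z + ad y z.
Proof. by rewrite !adE mulrDl mulrDr opprD addrACA. Qed.

Lemma adDr x y z : ad x (y + z) = ad x y + ad x z.
Proof. by rewrite !adE mulrDl mulrDr opprD addrACA. Qed.

Lemma adNl x y : ad (- x) y = - ad x y.
Proof. by rewrite !adE mulNr mulrN opprB opprK addrC. Qed.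

Lemma adNr x y : ad x (- y) = - ad x y.
Proof. by rewrite !adE mulNr mulrN opprB opprK addrC. Qed.

Lemma adBl x y z : ad (x - y) z = ad x z - ad y z.
Proof. by rewrite adDl adNl. Qed.

Lemma adBr x y z : ad x (y - z) = ad x y - ad x z.
Proof. by rewrite adDr adNr. Qed.

Lemma adMr x y z : ad x (y * z) = ad x y * z + y * ad x z.
Proof. by rewrite !adE mulrBl mulrBr !mulrA addrA subrK. Qed.

Lemma adMl x y z : ad (x * y) z = x * ad y z + ad x z * y.
Proof. by rewrite !adE mulrBl mulrBr !mulrA addrA subrK. Qed.

Lemma ad_centerl c x : C c -> ad c x = 0.
Proof. by move=> Cc; rewrite adE (centerE x Cc) subrr. Qed.

Lemma ad_centerr c x : C c -> ad x c = 0.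
Proof. by move=> Cc; rewrite adE (centerE x Cc) subrr. Qed.

Lemma adZl c x y : C c -> ad (c * x) y = c * ad x y.
Proof. by move=> Cc; rewrite adMl (ad_centerl _ Cc) mul0r addr0. Qed.

Lemma adZr c x y : C c -> ad x (c * y) = c * ad x y.
Proof. by move=> Cc; rewrite adMr (ad_centerr _ Cc) mul0r add0r. Qed.

Lemma ad_jacobi x y z : ad x (ad y z) = ad (ad x y) z + ad y (ad x z).
Proof.
rewrite {1}[ad y z]adE adBr !adMr; set u := ad x y; set v := ad x z.
by rewrite opprD [- _ - _]addrC addrACA.
Qed.

End Commutator.

(** * Characteristic 2, where commutators are symmetric and squares of derivations are
    derivations *)

Section CharTwo.
Variable Q : nzRingType.
Hypothesis char2 : forall x : Q, x + x = 0.
Implicit Types (c x y z : Q).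

Lemma opp_char2 x : - x = x.
Proof. by apply: (addrI x); rewrite subrr char2. Qed.

Lemma ad_char2 x y : ad x y = x * y + y * x.
Proof. by rewrite adE opp_char2. Qed.

Lemma adC x y : ad x y = ad y x.
Proof. by rewrite !ad_char2 addrC. Qed.

(** [[x x, y]] expands to [x [x, y] + [x, y] x], which in characteristic 2 is again a commutator. *)
Lemma ad_sq x y : ad (x * x) y = ad x (ad x y).
Proof. by rewrite adMl [RHS]ad_char2. Qed.

Lemma derivation_comb (D1 D2 : Q -> Q) k l : derivation D1 -> derivation D2 ->
  rng_center Q k -> rng_center Q l -> derivation (fun x => k * D1 x + l * D2 x).
Proof.
move=> [D1D D1M] [D2D D2M] Ck Cl; split=> x y.
  by rewrite D1D D2D !mulrDr addrACA.
rewrite D1M D2M; change (k * (x * D1 y + D1 x * y) + l * (x * D2 y + D2 x * y) =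
  x * (k * D1 y + l * D2 y) + (k * D1 x + l * D2 x) * y).
by rewrite !mulrDr !mulrDl !mulrA (centerE x Ck) (centerE x Cl) addrACA.
Qed.

(** The mixed term [D x * D y] occurs twice in [D (D (x * y))] and cancels. *)
Lemma derivation_square (D : Q -> Q) : derivation D -> derivation (D \o D).
Proof.
move=> [DD DM]; have {}DM x y : D (x * y) = x * D y + D x * y by apply: DM.
split=> x y /=; first by rewrite !DD.
change (D (D (x * y)) = x * D (D y) + D (D x) * y).
by rewrite DM DD !DM -addrA (addrA (D x * D y)) char2 add0r.
Qed.

Lemma derivation_ad_inner (g : Q) : derivation (ad g).
Proof. by split=> x y; [apply: adDr | rewrite [RHS]addrC; apply: adMr]. Qed.

End CharTwo.

(* In dimension 4 these properties make [A] equal to [C[a] + C[a] b]. *)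
Record weyl_frame (Q : nzRingType) (A : set Q) (a b : Q) : Prop := {
  wf_inv : forall c, rng_center Q c -> c <> 0 ->
    exists2 c', rng_center Q c' & c' * c = 1;
  wf_char2 : forall x : Q, x + x = 0;
  wf_D : forall x y, A x -> A y -> A (x + y);
  wf_M : forall x y, A x -> A y -> A (x * y);
  wf_C : forall c, rng_center Q c -> A c;
  wf_dim : ext_dim A 4;
  wf_a : A a;
  wf_b : A b;
  wf_a2 : rng_center Q (a * a);
  wf_ab1 : ad a b = 1
}.

(** * The trace on a four-dimensional algebra in characteristic 2 *)

Section QuaternionAlgebra.
Variables (Q : nzRingType) (A : set Q) (a b : Q).
Hypothesis F : weyl_frame A a b.
Local Notation C := (rng_center Q).
Implicit Types (c p q r s t x y z : Q).

Let center_inv := wf_inv F.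
Let char2 := wf_char2 F.
Let AD := wf_D F.
Let AM := wf_M F.
Let AC := wf_C F.
Let A_dim := wf_dim F.
Let Aa := wf_a F.
Let Ab := wf_b F.
Let Ca2 := wf_a2 F.
Let ab1 := wf_ab1 F.

Lemma frame_noncentral : ~ C a.
Proof.
by move=> Ca; have := ab1; rewrite ad_centerl // => /esym/eqP; rewrite oner_eq0.
Qed.

Let Ca := frame_noncentral.

Local Notation oppr2 := (opp_char2 char2).

Lemma A_ad x y : A x -> A y -> A (ad x y).
Proof. by move=> Ax Ay; rewrite (ad_char2 char2); apply: AD; apply: AM. Qed.

Lemma center_scale_noncentral c z : C c -> ~ C z -> C (c * z) -> c = 0.
Proof.
move=> Cc nCz Ccz; have [//|/eqP c0] := eqVneq c 0.
by case: nCz; apply: center_divl Ccz.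
Qed.

Lemma Ca_free p q : C p -> C q -> p + q * a = 0 -> p = 0 /\ q = 0.
Proof.
move=> Cp Cq pq0; have q0 : q = 0.
  apply: (center_scale_noncentral Cq Ca).
  by move/eqP: pq0; rewrite addrC addr_eq0 => /eqP->; apply: centerN.
by move: pq0; rewrite q0 mul0r addr0.
Qed.

(** The five elements [1, a, s, b, a b] are dependent in dimension 4. Applying [ad a] to a relation
    leaves the coefficients of [b] and [a b] as a combination of [1] and [a], so both vanish. The
    coefficient of [s] is then nonzero, because [1] and [a] are independent. *)
Lemma centralizer_a s :
  A s -> ad a s = 0 -> exists p q, [/\ C p, C q & s = p + q * a].
Proof.
move=> As as0; pose v := [:: 1; a; s; b; a * b].
have [|c [cC cn0]] := ext_dim_dependent center_inv (v := fun i => v`_i) A_dim.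
  move=> [[|[|[|[|[|//]]]]] _] //=; last exact: AM.
  by apply/AC/center1.
pose k n := c (inord n).
have cE i : c i = k i by rewrite /k inord_val.
have Ck n : C (k n) by apply: cC.
rewrite 5!big_ord_recl big_ord0 !cE /= /bump /= mulr1 addr0 !addrA add1n => k0.
have := congr1 (ad a) k0; rewrite !adDr !(adZr _ _ (Ck _)) as0 adMr ab1.
rewrite !(ad_centerr a (Ck _)) [in RHS](ad_centerr _ (@center0 _)).
rewrite !adE !subrr !mulr1 mul0r !mulr0 !add0r => /(Ca_free (Ck _) (Ck _)) [k3 k4].
move: k0; rewrite k3 k4 !mul0r !addr0 => k0.
have k2 : k 2 <> 0.
  move=> k2; move: k0; rewrite k2 mul0r addr0 => /(Ca_free (Ck _) (Ck _)) [k00 k1].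
  case: cn0 => i; apply; rewrite cE.
  by case: i => [[|[|[|[|[|//]]]]] lt_i5] /=.
have [l Cl l1] := center_inv (Ck 2) k2.
exists (l * k 0), (l * k 1); split; [exact: centerM..|].
rewrite -mulrA -mulrDr; move/eqP: k0; rewrite addr_eq0 oppr2 => /eqP->.
by rewrite mulrA l1 mul1r.
Qed.

(** For [x = p + q a + (s + t a) b] the commutator [[a, x]] is [s + t a], so [t] is the coefficient
    of [a b]; by [has_trace_norm] it is the reduced trace. *)
Definition has_trace x t := C t /\ C (ad a x - t * a).

(** By [ad_sq], [[a, [a, x]] = [a ^ 2, x] = 0], so [[a, x]] lies in the centralizer [C + C a]. *)
Lemma trace_exists x : A x -> exists t, has_trace x t.
Proof.
move=> Ax; have [||p [q [Cp Cq axE]]] := @centralizer_a (ad a x).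
- exact: A_ad.
- by rewrite -(ad_sq char2) ad_centerl.
by exists q; split; rewrite // axE addrK.
Qed.

(** Modulo [C], [[a, x]] is [t a] and [[a, y]] is [u a]. The Jacobi identity then turns [[a,
    [x, y]]] into [t u a + u t a = 0] modulo [C]. *)
Lemma has_trace_ad x y : A x -> A y -> has_trace (ad x y) 0.
Proof.
move=> Ax Ay; split; first exact: center0.
have [t [Ct Cx]] := trace_exists Ax; have [u [Cu Cy]] := trace_exists Ay.
rewrite mul0r subr0 ad_jacobi -[ad a x](subrK (t * a)) -[ad a y](subrK (u * a)).
rewrite adDl adDr (ad_centerl y Cx) (ad_centerr x Cy) !add0r adZl // adZr //.
rewrite -[ad a y](subrK (u * a)) (adC char2 x) -[ad a x](subrK (t * a)) (mulrDr t) (mulrDr u).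
rewrite addrACA; apply: centerD; first by apply: centerD; apply: centerM.
by rewrite !mulrA (centerE t Cu) char2; apply: center0.
Qed.

(** Both [x] and [(s + t a) b] have commutator [s + t a] with [a], so their sum centralizes [a]. *)
Lemma trace_decomposition x t : A x -> has_trace x t ->
  exists p q s, [/\ C p, C q, C s & x = p + q * a + (s + t * a) * b].
Proof.
move=> Ax [Ct Cx]; set s := ad a x - t * a in Cx.
have axE : ad a x = s + t * a by rewrite subrK.
have Ata : A (t * a) by apply: AM => //; apply: AC.
have [||p [q [Cp Cq xE]]] := @centralizer_a (x + (s + t * a) * b).
- by apply: AD => //; apply/AM/Ab/AD => //; apply: AC.
- rewrite adDr axE adMr ab1 mulr1 adDr adZr // ad_centerr // adE subrr mulr0.
  by rewrite addr0 mul0r add0r char2.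
exists p, q, s; split=> //.
by rewrite -xE -addrA char2 addr0.
Qed.

Lemma ad_trace_b x t : A x -> has_trace x t -> C (ad x b - t * b).
Proof.
move=> Ax xt; have [p [q [s [Cp Cq Cs xE]]]] := trace_decomposition Ax xt.
have Ct := proj1 xt.
rewrite {1}xE adDl [ad ((s + t * a) * b) b]adMl [ad b b]adE subrr mulr0 add0r !adDl.
rewrite (ad_centerl b Cp) (ad_centerl b Cs) !adZl // ab1 !mulr1 !add0r.
by rewrite addrK.
Qed.

(** A trace-zero [z] is a combination of [1], [a] and [b]. For [a] the claim is the definition of
    the trace, for [b] it is [ad_trace_b], and [1] contributes a central term. *)
Lemma ad_trace x z t : A x -> A z -> has_trace x t -> has_trace z 0 ->
  C (ad x z - t * z).
Proof.
move=> Ax Az xt z0; have [p [q [s [Cp Cq Cs zE]]]] := trace_decomposition Az z0.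
have Cxb := ad_trace_b Ax xt; have [Ct Cxa] := xt.
have -> : ad x z - t * z = q * (ad a x - t * a) + s * (ad x b - t * b) - t * p.
  rewrite zE mul0r addr0 !adDr (ad_centerr x Cp) !adZr // add0r (adC char2 x a).
  move: (ad a x) (ad x b) => u v.
  rewrite !mulrDr !mulrN !mulrA (centerE t Cq) (centerE t Cs) !opprD.
  by rewrite [q * u - _ + _]addrACA -[in LHS](addrA (- (t * p))) [- (t * p) + _]addrC !addrA.
by apply/centerD/centerN/centerM => //; apply/centerD; apply/centerM.
Qed.

(** Any noncentral [z] of trace zero can replace [a] in reading off the trace: if [u] is the trace
    of [x], then [(t - u) z] is central, which forces [t = u]. *)
Lemma has_trace_detect x z t : A x -> A z -> has_trace z 0 -> ~ C z -> C t ->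
  C (ad x z - t * z) -> has_trace x t.
Proof.
move=> Ax Az z0 nCz Ct Cxz; have [u xu] := trace_exists Ax.
suff -> : t = u by [].
apply/eqP; rewrite -subr_eq0; apply/eqP.
have [Cu _] := xu; have Ctu : C (t - u) by apply/centerD/centerN.
apply: (center_scale_noncentral Ctu nCz).
have -> : (t - u) * z = (ad x z - u * z) - (ad x z - t * z).
  by rewrite opprB [_ - u * z]addrC addrACA subrr addr0 mulrBl addrC.
by apply/centerD/centerN => //; apply: ad_trace.
Qed.

(* Cayley-Hamilton: the element [x ^ 2 + t x] is the norm of [x]. *)
Lemma has_trace_norm x t : A x -> has_trace x t -> C (x * x + t * x).
Proof.
move=> Ax xt; have [Ct Cxa] := xt; have Cxb := ad_trace_b Ax xt.
(* This applies to [y = a], which puts the norm in [C + C a], and to [y = b], which removes the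
   multiple of [a]. *)
have tr y : C (ad x y - t * y) -> ad y (x * x + t * x) = 0.
  move=> Cy; rewrite adDr adMr adZr // (adC char2 y) -{1 2}[ad x y](subrK (t * y)).
  rewrite mulrDl mulrDr addrACA (centerE x Cy) char2 add0r.
  rewrite mulrA -(centerE x Ct) -!mulrA -mulrDr -mulrDr -(ad_char2 char2) (adC char2 y).
  by rewrite char2 mulr0.
have Ax2 : A (x * x + t * x) by apply: AD; apply: AM => //; apply: AC.
have [|p [q [Cp Cq xE]]] := centralizer_a Ax2; first by apply: tr; rewrite (adC char2).
have := tr b Cxb; rewrite xE adDr ad_centerr // adZr // (adC char2) ab1 mulr1 add0r => q0.
by rewrite q0 mul0r addr0.
Qed.

(** The three pieces of [z = p + q a + s b] are the commutators [[p a, b]], [[a, q a b]] and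
    [[s b, a b]]. *)
Lemma commset_trace0 z : A z -> has_trace z 0 -> commset A A z.
Proof.
move=> Az z0; have [p [q [s [Cp Cq Cs ->]]]] := trace_decomposition Az z0.
have gen x y : A x -> A y -> commset A A (ad x y).
  by move=> Ax Ay; apply: sub_gen_smallest; exists x => //; exists y.
have MD x y : commset A A x -> commset A A y -> commset A A (x + y).
  by apply: add_subgroupD; apply: smallest_add_subgroup.
rewrite mul0r addr0; apply: (MD); first apply: MD.
- have -> : p = ad (p * a) b by rewrite adZl // ab1 mulr1.
  by apply: gen => //; apply: AM => //; apply: AC.
- have -> : q * a = ad a (q * (a * b)).
    by rewrite adZr // adMr ab1 adE subrr mul0r add0r mulr1.
  by apply: gen => //; apply: AM => //; [apply: AC | apply: AM].
- have -> : s * b = ad (s * b) (a * b).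
    by rewrite adZl // adMr [ad b b]adE subrr mulr0 addr0 (adC char2) ab1 mul1r.
  by apply: gen; apply: AM => //; apply: AC.
Qed.

Lemma commset_has_trace0 z : commset A A z -> A z /\ has_trace z 0.
Proof.
move=> zM; suff: [set x | A x /\ has_trace x 0] z by [].
apply: (smallest_sub _ _ zM); last first.
  by move=> _ [x Ax [y Ay <-]]; split; [apply: A_ad | apply: has_trace_ad].
split.
  by split; [apply/AC/center0|split; rewrite ?mul0r ?subr0 ?ad_centerr; apply: center0].
move=> x y [Ax [_ x0]] [Ay [_ y0]]; split; first by rewrite oppr2; apply: AD.
split; first exact: center0.
move: x0 y0; rewrite mul0r !subr0 => x0 y0.
by rewrite adBr; apply/centerD/centerN.
Qed.

(** * Derivations of the algebra: effect on the trace, and innerness *)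

Section Derivation.
Variable E : Q -> Q.
Hypothesis E_der : derivation E.
Hypothesis EA : forall x, A x -> A (E x).
Hypothesis EC : forall x, C x -> C (E x).

Let ED : forall x y, E (x + y) = E x + E y := proj1 E_der.
Let EM : forall x y, E (x * y) = x * E y + E x * y := proj2 E_der.

(** Applying [E] to the central element [a * a] shows that [[a, E a]] is central. *)
Lemma has_trace_derivation_a : has_trace (E a) 0.
Proof.
split; first exact: center0.
by rewrite mul0r subr0 (ad_char2 char2) -EM; apply: EC.
Qed.

Lemma derivation_ad x y : E (ad x y) = ad (E x) y + ad x (E y).
Proof.
by rewrite !(ad_char2 char2) ED !EM [x * _ + _]addrC addrACA.
Qed.

(** In [E [a, z] = [E a, z] + [a, E z]] the left side is central, and so is [[E a, z]], since [E a]
    and [z] have trace zero. *)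
Lemma has_trace_derivation z : A z -> has_trace z 0 -> has_trace (E z) 0.
Proof.
move=> Az z0; have [_ Cz] := z0; split; first exact: center0.
move: Cz; rewrite mul0r !subr0 => Cz.
have -> : ad a (E z) = E (ad a z) - ad (E a) z by rewrite derivation_ad addrC addKr.
apply/centerD/centerN; first exact: EC.
have := ad_trace (EA Aa) Az has_trace_derivation_a z0.
by rewrite mul0r subr0.
Qed.

(** [C], [a] and [b] generate [A], so it suffices to match [E] on [a] and [b]: [g] is chosen for [a]
    first and then corrected for [b] by a multiple of [a]. *)
Lemma derivation_inner : (forall c, C c -> E c = 0) ->
  exists2 g, A g & forall x, A x -> E x = ad g x.
Proof.
move=> Ec0; have Ecx c x : C c -> E (c * x) = c * E x.
  by move=> Cc; rewrite EM (Ec0 c Cc) mul0r addr0.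
have aEa : ad a (E a) = 0 by rewrite (ad_char2 char2) -EM Ec0.
have [p [q [Cp Cq EaE]]] := centralizer_a (EA Aa) aEa.
(* As [[b, a] = 1] and [[a b, a] = a], this gives [[g, a] = p + q a = E a]. *)
pose g := p * b + q * (a * b).
have Ag : A g by apply: AD; apply: AM => //; [apply: AC | apply: AC | apply: AM].
have ga : ad g a = E a.
  rewrite adDl (adZl _ _ Cp) (adZl _ _ Cq) adMl (adC char2 b) ab1.
  rewrite [ad a a]adE subrr mul0r addr0 mulr1.
  by rewrite mulr1 EaE.
pose G x := E x - ad g x.
have FD x y : G (x + y) = G x + G y by rewrite /G ED adDr opprD addrACA.
have FM x y : G (x * y) = x * G y + G x * y.
  rewrite /G EM adMr; move: (E x) (E y) (ad g x) (ad g y) => Ex Ey gx gy.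
  by rewrite mulrBr mulrBl [in LHS](addrC (gx * y)) opprD addrACA.
have FA x : A x -> A (G x) by move=> Ax; rewrite /G oppr2; apply: AD; [apply: EA|apply: A_ad].
have Fc c : C c -> G c = 0 by move=> Cc; rewrite /G Ec0 // ad_centerr // subrr.
have Fa : G a = 0 by rewrite /G ga subrr.
have F0 : G 0 = 0 by apply: Fc; apply: center0.
have Fad x y : G (ad x y) = ad x (G y) + ad (G x) y.
  by rewrite !(ad_char2 char2) FD !FM [y * _ + _]addrC addrACA.
have [|r [s [Cr Cs FbE]]] := centralizer_a (FA _ Ab).
  have := Fad a b; rewrite ab1 Fa Fc; last exact: center1.
  by rewrite (ad_centerl b (@center0 _)) addr0.
(* Since [[a, b * b] = b + b = 0], [b * b] lies in [C + C a], which [G] kills. Hence [0 = G (b * b)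
   = [b, G b] = s]. *)
have [||u [v [Cu Cv b2E]]] := @centralizer_a (b * b).
- exact: AM.
- by rewrite adMr ab1 mul1r mulr1 char2.
have s0 : s = 0.
  have := congr1 G b2E; rewrite FD !FM Fa (Fc _ Cu) (Fc _ Cv) mulr0 mul0r !addr0.
  rewrite -(ad_char2 char2) FbE adDr ad_centerr // add0r adZr // (adC char2) ab1.
  by rewrite mulr1.
(* [[r a, b] = r] supplies the remaining value of [G b], and [r a] commutes with [a]. *)
exists (g + r * a); first by apply: AD => //; apply: AM => //; apply: AC.
have gb : ad (g + r * a) b = E b.
  rewrite adDl adZl // ab1 mulr1; move: FbE; rewrite s0 mul0r addr0 /G => <-.
  by rewrite addrC subrK.
have ga' : ad (g + r * a) a = E a by rewrite adDl adZl // [ad a a]adE subrr mulr0 addr0 ga.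
move=> x Ax; have [t xt] := trace_exists Ax; have [Ct _] := xt.
have [p' [q' [s' [Cp' Cq' Cs' ->]]]] := trace_decomposition Ax xt.
rewrite !(ED, EM) (Ec0 _ Cp') (Ec0 _ Cq') (Ec0 _ Cs') (Ec0 _ Ct).
rewrite !adDr (adZr _ _ Cq') [ad _ (_ * b)]adMr adDr (adZr _ _ Ct) gb ga'.
rewrite (ad_centerr _ Cp') (ad_centerr _ Cs') !mul0r !add0r !addr0.
by rewrite [X in _ = _ + X]addrC.
Qed.

End Derivation.

End QuaternionAlgebra.

(** * Inner derivations of a prime ring whose values commute and have square zero *)

Section NilInnerDerivation.
Variables (Q : nzRingType) (P : set Q) (a : Q).
Hypothesis char2 : forall x : Q, x + x = 0.
Hypothesis PM : forall x y, P x -> P y -> P (x * y).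
Hypothesis P_prime : forall x y, P x -> P y -> (forall z, P z -> x * z * y = 0) ->
  x = 0 \/ y = 0.
Hypothesis Pad : forall x, P x -> P (ad a x).
Hypothesis adad : forall x, P x -> ad a (ad a x) = 0.
Hypothesis ad_comm : forall x y, P x -> P y -> ad a x * ad a y = ad a y * ad a x.
Hypothesis ad_nil : forall x, P x -> ad a x * ad a x = 0.
Implicit Types x y z : Q.

(** With [u = [a, y]] and [v = [a, x]], the commuting of [u] with [[a, y x] = u x + y v] gives
    [u x u = u y v + y u v]. *)
Let sandwich x y : P x -> P y -> ad a y * x * ad a y = ad a (y * y) * ad a x.
Proof.
move=> Px Py; have := ad_comm Py (PM Py Px); rewrite !adMr.
have := ad_nil Py; have := ad_comm Px Py; set u := ad a y; set v := ad a x.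
move: u v => u v vu uu; rewrite mulrDr mulrA uu mul0r add0r !mulrDl => e.
rewrite -[y * v * u]mulrA vu mulrA mulrA in e.
by rewrite e -addrA char2 addr0.
Qed.

(** With [u = [a, y]] and [w = [a, y ^ 2]], [sandwich] gives [u w [a, t] = u (u t u) = 0] for all
    [t]. Taking [t = x y] leaves [u w x u = 0] for all [x], and primeness applies. *)
Let sandwich_nil y : P y -> ad a y * ad a (y * y) = 0.
Proof.
move=> Py; have Pyy := PM Py Py; have uw0 t : P t -> ad a y * ad a (y * y) * ad a t = 0.
  by move=> Pt; rewrite -mulrA -sandwich // !mulrA ad_nil // !mul0r.
case: (@P_prime (ad a y * ad a (y * y)) (ad a y)) => //; first by apply: PM; apply: Pad.
- by apply: Pad.
- move=> x Px; have := uw0 _ (PM Px Py); have := uw0 _ Px; rewrite [ad a (x * y)]adMr.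
  move: (ad a y * ad a (y * y)) (ad a x) (ad a y) => w v u wv0.
  by rewrite mulrDr mulrA wv0 mul0r add0r mulrA.
- by move=> ->; rewrite mul0r.
Qed.

(* With [u = ad a y], every [n = u x u] satisfies [n P n = 0]. *)
Lemma ad_nil_eq0 y : P y -> ad a y = 0.
Proof.
move=> Py; have Pyy := PM Py Py; have Pu := Pad Py.
have w0 := sandwich_nil Py; have uu := ad_nil Py; have au := adad Py.
have [] // : ad a y = 0 \/ ad a y = 0.
apply: P_prime => // x Px; have Pn : P (ad a y * x * ad a y) by do 2!apply: PM => //.
have [] // : ad a y * x * ad a y = 0 \/ ad a y * x * ad a y = 0.
apply: P_prime => // z Pz.
have -> : ad a y * x * ad a y * z * (ad a y * x * ad a y) =
    ad a y * (x * (ad a y * (z * (ad a y * x)))) * ad a y by rewrite !mulrA.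
rewrite sandwich //; last by do 4!apply: (PM) => //.
have sz := sandwich Pz Py; have sx := sandwich Px Pyy.
have vw := ad_comm Px Pyy; have uw := ad_comm Py Pyy.
have uz := ad_comm Py Pz; have vz := ad_comm Px Pz; have vv := ad_nil Px.
have adE5 u : ad a u = 0 -> ad a (x * (u * (z * (u * x)))) =
    ad a x * (u * (z * (u * x))) + x * (u * (ad a z * (u * x) + z * (u * ad a x))).
  by move=> u0; rewrite !adMr u0 !mul0r !add0r.
rewrite adE5 //.
move: w0 uu sz sx vw uw uz vz vv.
move: (ad a y) (ad a x) (ad a z) (ad a (y * y)) (ad a (y * y * (y * y))).
move=> u v t w w' w0 uu sz sx vw uw uz vz vv.
(* The term with [v] in front dies by [u w = 0] and the term with [t] by [u u = 0]. Two uses of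
   [sandwich] turn the last one into [w' v t v], which vanishes since [v v = 0]. *)
rewrite !mulrDr.
have -> : w * (v * (u * (z * (u * x)))) = 0.
  by rewrite mulrA -vw -mulrA (mulrA w) -uw w0 mul0r mulr0.
have -> : u * (t * (u * x)) = 0 by rewrite mulrA uz -mulrA (mulrA u) uu mul0r mulr0.
rewrite mulr0 mulr0 !add0r (mulrA u) (mulrA (u * z)) sz.
by rewrite mulrA (mulrA (w * x)) (mulrA (w * x)) sx -(mulrA w') vz mulrA -mulrA -mulrA vv !mulr0.
Qed.

End NilInnerDerivation.

(** * The extended centroid as a field and the central closure as a ring *)

Section CentralClosure.
Variables (R : rngType) (Q : nzRingType) (iota : {additive R -> Q}).
Hypotheses (R_prime : prime_rng R) (Q_sym : symmetric_quotients iota).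
Local Notation C := (rng_center Q).
Local Notation RC := (central_closure iota).
Implicit Types (r s : R) (c p q x y z : Q).

Let iM r s : iota (r ** s) = iota r * iota s := sqM Q_sym r s.

Let iota_eq0 r : iota r = 0 -> r = 0.
Proof. by rewrite -(raddf0 iota) => /(sq_inj Q_sym). Qed.

Lemma iota_ad r s : iota (ad r s) = ad (iota r) (iota s).
Proof. by rewrite raddfB /= !iM. Qed.

Lemma iota_prime p q : range iota p -> range iota q ->
  (forall x, range iota x -> p * x * q = 0) -> p = 0 \/ q = 0.
Proof.
move=> [r _ <-] [s _ <-] rs0; case: (proj2 R_prime r s) => [x||].
- by apply: iota_eq0; rewrite !iM rs0 //; exists x.
- by move->; left; rewrite raddf0.
- by move->; right; rewrite raddf0.
Qed.

Lemma ext_char2 : (forall r, r *+ 2 = 0) -> forall q, q + q = 0.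
Proof.
move=> char2 q; have [[r rn0] _] := R_prime.
apply: (sq_faithful Q_sym (I := setT)) => //.
  by move=> T0; apply: rn0; have : [set: R] r by []; rewrite T0.
by left=> x _; rewrite mulrDl -mulrDr -raddfD -mulr2n char2 raddf0 mulr0.
Qed.

(** Multiplication by [iota x], with [x] in a denominator ideal of [p], moves [p] into the image of
    [R], where [q] commutes. *)
Lemma ext_centroid_commute q : (forall r, q * iota r = iota r * q) -> C q.
Proof.
move=> qC; apply: centerI => p; apply/eqP; rewrite -subr_eq0; apply/eqP.
have [I [I_id In0 Ip]] := sq_denom Q_sym p.
apply: (sq_faithful Q_sym I_id In0); left => x /Ip[[u _ uE] _].
by rewrite mulrBl -!mulrA qC (mulrA p) -uE qC subrr.
Qed.

Lemma center_iota r : rng_center R r <-> C (iota r).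
Proof.
split=> [Zr|Cr s]; last by apply: (sq_inj Q_sym); rewrite !iM centerE.
by apply: ext_centroid_commute => s; rewrite -!iM Zr.
Qed.

(** Multiplication by [c] maps a denominator ideal [I] injectively onto an ideal [J]. The inverse
    map [f] is a module map on both sides, so by completeness it is multiplication by an element of
    [Q]. *)
Lemma ext_centroid_inv c : C c -> c <> 0 -> exists2 c', C c' & c' * c = 1.
Proof.
move=> Cc cn0; have [I [[[I0 IB] IM] In0 Ic]] := sq_denom Q_sym c.
have [y0 [Iy0 cy0]] : exists y : R, I y /\ c * iota y <> 0.
  apply: contrapT => nex; apply: cn0; apply: (sq_faithful Q_sym (I := I)) => //.
  by left=> x Ix; apply: contrapT => cx; apply: nex; exists x.
(* If [c] kills [r], then [r] times [R] times the nonzero [c y0] is zero, and primeness gives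
   [r = 0]. *)
have reg r : c * iota r = 0 -> r = 0.
  move=> cr0; have [[m _ mE] _] := Ic _ Iy0.
  case: (proj2 R_prime r m) => [s|//|m0]; last by case: cy0; rewrite -mE m0 raddf0.
  by apply: iota_eq0; rewrite !iM mE !mulrA -(centerE _ Cc) !mulrA cr0 !mul0r.
have reg_inj r s : c * iota r = c * iota s -> r = s.
  move/eqP; rewrite -subr_eq0 -mulrBr -raddfB => /eqP/reg/eqP.
  by rewrite subr_eq0 => /eqP.
pose J : set R := [set m | exists2 r, I r & iota m = c * iota r].
have /choice [f fE] : forall m, exists r, J m -> I r /\ iota m = c * iota r.
  move=> m; have [[r Ir mE]|nJ] := pselect (J m); last by exists 0.
  by exists r.
have fP m r : J m -> iota m = c * iota r -> f m = r.
  by move=> /fE[_ ->] /reg_inj.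
have J_id : rng_ideal J.
  split; first split.
  - by exists 0; rewrite ?raddf0 ?mulr0.
  - move=> m n [r Ir mE] [s Is nE]; exists (r - s); first exact: IB.
    by rewrite !raddfB /= mulrBr mE nE.
  - move=> x m [r Ir mE]; have [Ixr Irx] := IM x r Ir; split.
      by exists (x ** r) => //; rewrite !iM mE !mulrA (centerE _ Cc).
    by exists (r ** x) => //; rewrite !iM mE mulrA.
have Jn0 : J <> [set 0].
  move=> J0; have [[m _ mE] _] := Ic _ Iy0; apply: cy0; rewrite -mE.
  have : J m by exists y0.
  by rewrite J0 => ->; rewrite raddf0.
have fD m n : J m -> J n -> f (m + n) = f m + f n.
  move=> Jm Jn; have [Ifm fm] := fE _ Jm; have [Ifn fn] := fE _ Jn.
  apply: fP; last by rewrite !raddfD /= mulrDr fm fn.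
  exists (f m + f n); last by rewrite !raddfD /= mulrDr fm fn.
  by rewrite -[f n]opprK; apply: (IB) => //; rewrite -sub0r; apply: IB.
have [|||||q qP] := @sq_complete _ _ _ Q_sym J f f J_id Jn0 => //.
- move=> m r Jm; have [Ifm fm] := fE _ Jm; apply: fP; last by rewrite !iM fm mulrA.
  by case: (proj2 J_id r m Jm).
- move=> m r Jm; have [Ifm fm] := fE _ Jm; apply: fP.
    by case: (proj2 J_id r m Jm).
  by rewrite !iM fm !mulrA (centerE _ Cc).
- move=> m n Jm Jn; have [_ fm] := fE _ Jm; have [_ fn] := fE _ Jn.
  by apply: (sq_inj Q_sym); rewrite !iM fm fn !mulrA (centerE _ Cc).
have qc1 : q * c = 1.
  apply/eqP; rewrite -subr_eq0; apply/eqP.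
  apply: (sq_faithful Q_sym (I := I)) => //; left=> x Ix.
  have [[m _ mE] _] := Ic _ Ix; have Jm : J m by exists x.
  by rewrite mulrBl mul1r -mulrA -mE (proj1 (qP _ Jm)) (fP m x) // subrr.
exists q => //; apply: centerI => x.
by rewrite -[x * q]mul1r -{1}qc1 -mulrA (centerE (x * q) Cc) -(mulrA x) qc1 mulr1.
Qed.

Lemma closure_ind (P : set Q) : add_subgroup P ->
  (forall r c, C c -> P (iota r * c)) -> forall x, RC x -> P x.
Proof.
move=> P_sub Pgen x RCx; apply: (smallest_sub _ _ RCx) => //.
by move=> _ [_ [r _ <-] [c Cc <-]]; apply: Pgen.
Qed.

Lemma closure_gen r c : C c -> RC (iota r * c).
Proof. by move=> Cc; apply: sub_gen_smallest; exists (iota r); [exists r|exists c => //]. Qed.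

Lemma closure_iota r : RC (iota r).
Proof. by rewrite -[iota r]mulr1; apply: closure_gen; apply: center1. Qed.

Lemma closureD x y : RC x -> RC y -> RC (x + y).
Proof. exact: add_subgroupD (smallest_add_subgroup _). Qed.

Lemma closureB x y : RC x -> RC y -> RC (x - y).
Proof. by case: (smallest_add_subgroup [set a * b | a in range iota & b in C]) => _; apply. Qed.

Lemma closureM x y : RC x -> RC y -> RC (x * y).
Proof.
have RC0 : RC 0 by case: (smallest_add_subgroup [set a * b | a in range iota & b in C]).
move=> RCx RCy; move: x RCx; apply: closure_ind.
  by split=> [|u v]; rewrite ?mul0r // mulrBl; apply: closureB.
move=> r c Cc; move: y RCy; apply: closure_ind.
  by split=> [|u v]; rewrite ?mulr0 // mulrBr; apply: closureB.
move=> s k Ck; rewrite mulrA -[iota r * c * _]mulrA (centerE _ Cc) mulrA -iM -mulrA.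
by apply: closure_gen; apply: centerM.
Qed.

(** * An extended derivation preserves [C] and [RC] *)

Section Extension.
Variables (d : R -> R) (D : Q -> Q).
Hypothesis D_ext : der_extension iota d D.

Lemma extM x y : D (x * y) = x * D y + D x * y.
Proof. by case: D_ext => -[_ DM] _; apply: DM. Qed.

Lemma extD x y : D (x + y) = D x + D y.
Proof. by case: D_ext => -[DD _] _; apply: DD. Qed.

Lemma ext_iota r : D (iota r) = iota (d r).
Proof. by case: D_ext. Qed.

Lemma ext_center c : C c -> C (D c).
Proof.
move=> Cc; apply: centerI => x; have := congr1 D (centerE x Cc).
by rewrite !extM (centerE _ Cc) [x * _ + _]addrC => /addrI.
Qed.

Lemma ext_closure x : RC x -> RC (D x).
Proof.
have D0 := derivation0 (proj1 D_ext).
have RC0 : RC 0 by rewrite -(raddf0 iota); apply: closure_iota.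
move: x; apply: closure_ind.
  split=> [|x y]; first by rewrite /= D0.
  by rewrite /= (derivation_sub _ _ (proj1 D_ext)); apply: closureB.
move=> r c Cc; rewrite /= extM ext_iota; apply: closureD; apply: closure_gen => //.
exact: ext_center.
Qed.

End Extension.

End CentralClosure.

(** * From an abelian Lie ideal to a frame of [RC] *)

Section LieIdeal.
Variables (R : rngType) (Q : nzRingType) (iota : {additive R -> Q}).
Hypotheses (R_prime : prime_rng R) (Q_sym : symmetric_quotients iota).
Hypothesis R_exc : exceptional iota.
Variable L : set R.
Hypotheses (L_lie : lie_ideal L) (L_abelian : lie_abelian L) (L_nc : noncentral L).
Local Notation C := (rng_center Q).
Local Notation Z := (rng_center R).
Local Notation RC := (central_closure iota).
Local Notation LC := (cspan iota L).
Implicit Types (r s z w : R) (c p q x y : Q).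

Let iM r s : iota (r ** s) = iota r * iota s := sqM Q_sym r s.
Let char2 : forall q, q + q = 0 := ext_char2 R_prime Q_sym (proj1 R_exc).
Let center_inv := ext_centroid_inv R_prime Q_sym.
Let iota_ad := iota_ad Q_sym.

Let L_ad z r : L z -> L (ad z r).
Proof.
by move=> Lz; case: L_lie => _; apply; apply: sub_gen_smallest; exists z => //; exists r.
Qed.

Let L_ad0 z w : L z -> L w -> ad z w = 0.
Proof.
move=> Lz Lw; suff : commset L L (ad z w) by rewrite L_abelian.
by apply: sub_gen_smallest; exists z => //; exists w.
Qed.

Let L_sq z : L z -> C (iota z * iota z).
Proof.
move=> Lz; apply: (ext_centroid_commute Q_sym) => r; apply/eqP; rewrite -subr_eq0.
rewrite -adE (ad_sq char2) -!iota_ad (L_ad0 Lz) ?raddf0 //; exact: L_ad.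
Qed.

(* By primeness some [u = [a, y]], an element of [L], has a nonzero and hence
   invertible square; then [b = u y / u ^ 2]. *)
Lemma lie_frame : exists a b, L a /\ weyl_frame RC (iota a) b.
Proof.
have [a La nCa] : exists2 a, L a & ~ C (iota a).
  apply: contrapT => nex; apply: L_nc => a La.
  by apply/(center_iota Q_sym); apply: contrapT => nCa; apply: nex; exists a.
have [y uu0] : exists y : R, iota (ad a y) * iota (ad a y) <> 0.
  apply: contrapT => nex; apply: nCa; apply: (ext_centroid_commute Q_sym) => r.
  apply/eqP; rewrite -subr_eq0 -adE; apply/eqP.
  apply: (@ad_nil_eq0 Q (range iota) (iota a) char2) => //.
  - by move=> _ _ [p _ <-] [q _ <-]; exists (p ** q); rewrite ?iM.
  - exact: (iota_prime R_prime Q_sym).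
  - by move=> _ [p _ <-]; exists (ad a p); rewrite ?iota_ad.
  - by move=> _ [p _ <-]; rewrite -!iota_ad (L_ad0 La) ?raddf0 //; apply: L_ad.
  - move=> _ _ [p _ <-] [q _ <-]; apply/eqP; rewrite -subr_eq0 -adE -!iota_ad.
    by rewrite L_ad0 ?raddf0 //; apply: L_ad.
  - move=> _ [p _ <-]; rewrite -!iota_ad; apply: contrapT => pp0; apply: nex.
    by exists p.
have [k Ck k1] := center_inv (L_sq (L_ad y La)) uu0.
(* The square of [[a, y]] lies in the image of [R] and has the central inverse [k]. *)
have closureC c : C c -> RC c.
  move=> Cc; have -> : c = iota (ad a y ** ad a y) * (k * c).
    by rewrite iM mulrA -(centerE _ Ck) k1 mul1r.
  by apply: closure_gen; apply: centerM.
exists a, (k * (iota (ad a y) * iota y)); split=> //; split=> //.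
- exact: closureD.
- exact: (closureM Q_sym).
- exact: (proj2 R_exc).
- exact: closure_iota.
- by rewrite -iM (centerE _ Ck); apply: closure_gen.
- exact: L_sq.
- by rewrite adZr // adMr -iota_ad (L_ad0 La) ?raddf0 ?mul0r ?add0r -?iota_ad //; apply: L_ad.
Qed.

(** * Consequences of a frame for [LC], [Z(R)] and [C] *)

Section Frame.
Variables (a0 : R) (b : Q).
Hypotheses (La0 : L a0) (F : weyl_frame RC (iota a0) b).
Local Notation trace := (has_trace (iota a0)).

Lemma lie_trace0 z : L z -> trace (iota z) 0.
Proof.
by move=> Lz; split; rewrite ?mul0r ?subr0 -?iota_ad ?L_ad0 ?raddf0 //; apply: center0.
Qed.

Lemma trace0_subgroup : add_subgroup [set x | RC x /\ trace x 0].
Proof.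
split=> [|x y [RCx [_ Tx]] [RCy [_ Ty]]].
  split; first by apply: (wf_C F); apply: center0.
  by split; rewrite ?mul0r ?subr0 ?ad_centerr; apply: center0.
split; first exact: closureB.
split; first exact: center0.
by move: Tx Ty; rewrite mul0r !subr0 adBr => Tx Ty; apply/centerD/centerN.
Qed.

Lemma cspan_trace0 x : LC x -> RC x /\ trace x 0.
Proof.
move=> LCx; apply: (smallest_sub trace0_subgroup _ LCx).
move=> _ [_ [r Lr <-] [c Cc <-]]; split; first exact: closure_gen.
have [_ Tr] := lie_trace0 Lr; split; first exact: center0.
move: Tr; rewrite !mul0r !subr0 => Tr.
by rewrite [_ ** _](esym (centerE _ Cc)) adZr //; apply: centerM.
Qed.

Lemma cspan_iota z : L z -> LC (iota z).
Proof.
move=> Lz; rewrite -[iota z]mulr1; apply: sub_gen_smallest.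
by exists (iota z); [exists z | exists 1 => //; apply: center1].
Qed.

(** A central [c] is [[a, c b]], and [ad a] maps [RC] into [LC] because [L] is a Lie ideal. *)
Lemma center_cspan c : C c -> LC c.
Proof.
move=> Cc; have -> : c = ad (iota a0) (c * b) by rewrite adZr // (wf_ab1 F) mulr1.
have : RC (c * b) by apply: closureM => //; [apply: (wf_C F) | apply: (wf_b F)].
move: (c * b); apply: closure_ind.
  have [LC0 LCB] := smallest_add_subgroup [set x * y | x in iota @` L & y in C].
  split=> [|x y LCx LCy] /=; last by rewrite adBr; apply: LCB.
  by rewrite (ad_centerr _ (@center0 Q)).
move=> r k Ck; rewrite /= adMr (ad_centerr _ Ck) mulr0 addr0 -iota_ad.
apply: sub_gen_smallest; exists (iota (ad a0 r)); last by exists k.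
by exists (ad a0 r) => //; apply: L_ad.
Qed.

Lemma commset_closure_ind (P : set Q) : add_subgroup P ->
  (forall c x, C c -> P x -> P (c * x)) -> (forall r s, P (iota (ad r s))) ->
  forall x y, RC x -> RC y -> P (ad x y).
Proof.
move=> P_sub PC Pgen x y RCx RCy; have [P0 PB] := P_sub; move: x RCx; apply: closure_ind.
  split=> [|u v] /=; first by rewrite (ad_centerl _ (@center0 Q)).
  by rewrite adBl; apply: PB.
move=> r c Cc; move: y RCy; apply: closure_ind.
  split=> [|u v] /=; first by rewrite (ad_centerr _ (@center0 Q)).
  by rewrite adBr; apply: PB.
move=> s k Ck; rewrite /= -(centerE _ Ck) -(centerE _ Cc) adZl // adZr // -iota_ad.
by apply: (PC) => //; apply: PC.
Qed.

Let ad_ab : ad (iota a0) (iota a0 * b) = iota a0.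
Proof. by rewrite adMr [ad (iota a0) (iota a0)]adE subrr mul0r add0r (wf_ab1 F) mulr1. Qed.

Let RCab : RC (iota a0 * b).
Proof. by apply: (closureM Q_sym); [apply: (wf_a F) | apply: (wf_b F)]. Qed.

(** [L] is not assumed stable under [Z(R)], but elements [[a0, r]] can be scaled inside it, as [s
    [a0, r] = [a0, s r]]. Not all are central, since [[a, a b] = a]. *)
Lemma lie_scalable : exists z, [/\ L z, ~ C (iota z) & forall r, Z r -> L (r ** z)].
Proof.
have [r nCr] : exists r, ~ C (iota (ad a0 r)).
  apply: contrapT => nex; apply: (frame_noncentral F); rewrite -ad_ab.
  move: (iota a0 * b) RCab; apply: closure_ind.
    split=> [|x y] /=; first by rewrite ad_centerr; apply: center0.
    by rewrite adBr => Cx Cy; apply/centerD/centerN.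
  move=> r c Cc; rewrite /= adMr (ad_centerr _ Cc) mulr0 addr0 -iota_ad.
  apply: centerM => //; apply: contrapT => nCr; apply: nex; by exists r.
exists (ad a0 r); split=> //; first exact: L_ad.
move=> s Zs; suff -> : s ** ad a0 r = ad a0 (s ** r) by apply: L_ad.
apply: (sq_inj Q_sym); rewrite iM !iota_ad iM adZr //.
exact/(center_iota Q_sym).
Qed.

(* The central element of a nonzero ideal comes from the identity
   [[k, [r, s]] \in C], valid for [k] in [C + C a]. *)
Lemma ext_centroid_fraction c : C c ->
  exists r s, [/\ Z r, r <> 0 & c * iota r = iota s].
Proof.
move=> Cc; have [I [[[I0 IB] IM] In0 Ic]] := sq_denom Q_sym c.
have I_ad r z : I z -> I (ad r z) /\ I (ad z r).
  by move=> Iz; have [Irz Izr] := IM r z Iz; split; apply: (IB).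
suff [r [Ir Zr rn0]] : exists r : R, [/\ I r, Z r & r <> 0].
  by have [[s _ sE] _] := Ic _ Ir; exists r, s.
have [x Ix xn0] : exists2 x : R, I x & x <> 0.
  apply: contrapT => nex; apply: In0; apply/seteqP; split=> [x Ix|x ->] //=.
  by apply: contrapT => xn0; apply: nex; exists x.
(* Either [x] commutes with [a0], or [[a0, x]] is a nonzero element of both [I] and [L]. *)
have [k [Ik kn0 ak0]] : exists k : R, [/\ I k, k <> 0 & ad (iota a0) (iota k) = 0].
  have [ax0|ax0] := pselect (ad a0 x = 0).
    by exists x; rewrite -iota_ad ax0 raddf0.
  exists (ad a0 x); split=> //; first by case: (I_ad a0 x Ix).
  by rewrite -iota_ad (L_ad0 La0) ?raddf0 //; apply: L_ad.
have [p [q [Cp Cq kE]]] := centralizer_a F (closure_iota k) ak0.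
have [q0|/eqP qn0] := eqVneq q 0.
  exists k; split=> //; apply/(center_iota Q_sym).
  by rewrite kE q0 mul0r addr0.
(* Otherwise all of [[RC, RC]] would commute with [a], yet [[b a, b] = b] does not. *)
have [r [s ars0]] : exists r s, ad (iota a0) (iota (ad r s)) <> 0.
  apply: contrapT => nex; have /eqP := oner_neq0 Q; apply.
  suff: [set x | ad (iota a0) x = 0] (ad (b * iota a0) b).
    by rewrite /= adMl [ad b b]adE subrr mul0r addr0 (wf_ab1 F) mulr1 => <-; rewrite (wf_ab1 F).
  apply: commset_closure_ind; last 1 first.
  - exact: (wf_b F).
  - split=> [|u v] /=; first by rewrite (ad_centerr _ (@center0 Q)).
    by rewrite adBr => -> ->; rewrite subrr.
  - by move=> u v Cu /=; rewrite adZr // => ->; rewrite mulr0.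
  - by move=> r s; apply: contrapT => rs0; apply: nex; exists r, s.
  - by apply: (closureM Q_sym); [apply: (wf_b F) | apply: (wf_a F)].
have [_] := has_trace_ad F (closure_iota r) (closure_iota s).
rewrite mul0r subr0 -iota_ad => Cars.
have iotaE : iota (ad k (ad r s)) = q * ad (iota a0) (iota (ad r s)).
  by rewrite iota_ad kE adDl (ad_centerl _ Cp) add0r adZl.
exists (ad k (ad r s)); split; first by case: (I_ad (ad r s) k Ik).
  by apply/(center_iota Q_sym); rewrite iotaE; apply: centerM => //; rewrite -iota_ad.
move=> kn; apply: ars0; apply: (center_mulI center_inv Cq qn0).
by rewrite -iotaE kn raddf0.
Qed.

(** With [c r = s] and [r], [s] in [Z(R)], the Leibniz rule leaves [E c * r = 0]. *)
Lemma derivation_center_eq0 (E : Q -> Q) : derivation E ->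
  (forall r, Z r -> E (iota r) = 0) -> forall c, C c -> E c = 0.
Proof.
move=> [_ EM] EZ c Cc; have [r [s [Zr rn0 crs]]] := ext_centroid_fraction Cc.
have Cr : C (iota r) by apply/(center_iota Q_sym).
have Zs : Z s by apply/(center_iota Q_sym); rewrite -crs; apply: centerM.
have E_cr : E (c * iota r) = c * E (iota r) + E c * iota r by apply: EM.
apply: (center_mulI center_inv Cr); first by rewrite -(raddf0 iota) => /(sq_inj Q_sym).
by move: E_cr; rewrite crs !EZ // mulr0 add0r (centerE _ Cr) => <-.
Qed.

Lemma ad_trace0 x y : RC x -> RC y -> trace x 0 -> trace y 0 -> C (ad x y).
Proof.
by move=> RCx RCy Tx Ty; have := ad_trace F RCx RCy Tx Ty; rewrite mul0r subr0.
Qed.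

Lemma trace0_detect z x : L z -> ~ C (iota z) -> RC x -> C (ad x (iota z)) -> trace x 0.
Proof.
move=> Lz nCz RCx Cxz; apply: (has_trace_detect F RCx (closure_iota z)) nCz _ _ => //.
- exact: lie_trace0.
- exact: center0.
- by rewrite mul0r subr0.
Qed.

(** * X-inner and X-outer derivations in terms of the trace and of [Z(R)] *)

Section OneDerivation.
Variables (d : R -> R) (D : Q -> Q).
Hypothesis D_ext : der_extension iota d D.

(** Moves the implementing element from [Q] into [RC], where it has a trace. *)
Lemma X_inner_ad : X_inner iota d -> exists2 g, RC g & forall x, RC x -> D x = ad g x.
Proof.
move=> [g g_ext]; rewrite (der_extension_unique Q_sym D_ext g_ext).
apply: (derivation_inner F) => [|x|c]; first exact: (derivation_ad_inner g).
  exact: (ext_closure g_ext).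
exact: ad_centerr.
Qed.

Lemma inner_derivation_center c : (exists2 g, RC g & forall x, RC x -> D x = ad g x) ->
  C c -> D c = 0.
Proof. by move=> [g _ DE] Cc; rewrite DE ?ad_centerr //; apply: (wf_C F). Qed.

(** A derivation that kills [Z(R)] kills its field of fractions [C], hence is inner by
    [derivation_inner]. *)
Lemma X_outer_center : X_outer iota d -> exists2 r, Z r & d r <> 0.
Proof.
move=> d_outer; apply: contrapT => nex; apply: d_outer.
have [|||g RCg DE] := @derivation_inner _ _ _ _ F D.
- by case: D_ext.
- exact: (ext_closure D_ext).
- apply: derivation_center_eq0; first by case: D_ext.
  move=> r Zr; rewrite (ext_iota D_ext); apply: contrapT => dr0; apply: nex; exists r => //.
  by move=> dr; apply: dr0; rewrite dr raddf0.
exists g; split=> [|r]; first exact: derivation_ad_inner.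
by rewrite -DE ?(ext_iota D_ext) //; apply: closure_iota.
Qed.

Lemma commset_trace r : commset [set: R] [set: R] r -> trace (iota r) 0.
Proof.
move=> RRr; suff: [set s | trace (iota s) 0] r by [].
apply: (smallest_sub _ _ RRr); last first.
  by move=> _ [s _ [w _ <-]] /=; rewrite iota_ad; apply: (has_trace_ad F); apply: closure_iota.
have [T0 TB] := trace0_subgroup.
split=> [|s w Ts Tw] /=; first by rewrite raddf0; case: T0.
by rewrite raddfB; case: (TB (iota s) (iota w)) => //; split=> //; apply: closure_iota.
Qed.

(** As [a = [a, a b]] lies in [[RC, RC]], the left side makes [[g, a]] central, so [g] has trace
    zero. The converse is [ad_trace], commutators having trace zero. *)
Lemma image_commset_center g : RC g -> (forall x, RC x -> D x = ad g x) ->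
  d @` commset [set: R] [set: R] `<=` Z <-> trace g 0.
Proof.
move=> RCg DE; split=> [dZ|g0].
  suff : C (ad g (iota a0)).
    by move=> Cga; split; rewrite ?mul0r ?subr0 1?(adC char2) //; apply: center0.
  suff : [set x | C (ad g x)] (ad (iota a0) (iota a0 * b)) by rewrite ad_ab.
  apply: commset_closure_ind => //; last exact: (wf_a F).
  - split=> [|u v] /=; first by rewrite (ad_centerr _ (@center0 Q)); apply: center0.
    by rewrite adBr => Cu Cv; apply/centerD/centerN.
  - by move=> u v Cu /= Cv; rewrite adZr //; apply: centerM.
  - move=> r s /=; rewrite -DE ?(ext_iota D_ext); last exact: closure_iota.
    apply/(center_iota Q_sym)/dZ; exists (ad r s) => //.
    by apply: sub_gen_smallest; exists r => //; exists s.
move=> _ [r RRr <-]; apply/(center_iota Q_sym).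
rewrite -(ext_iota D_ext) DE; last exact: closure_iota.
have := ad_trace F RCg (closure_iota r) g0 (commset_trace RRr).
by rewrite mul0r subr0.
Qed.

Lemma ext_trace0 x : RC x -> trace x 0 -> trace (D x) 0.
Proof.
apply: (has_trace_derivation F); first by case: D_ext.
  exact: (ext_closure D_ext).
exact: (ext_center D_ext).
Qed.

End OneDerivation.

(** * The four cases for a composition of two derivations *)

Section TwoDerivations.
Variables (delta d : R -> R) (Delta D : Q -> Q).
Hypotheses (Delta_ext : der_extension iota delta Delta) (D_ext : der_extension iota d D).
Local Notation ZL := ((delta \o d) @` L `<=` Z).
Local Notation RR := (commset [set: R] [set: R]).

Let DM := extM D_ext.
Let DD := extD D_ext.
Let DeltaM := extM Delta_ext.
Let DeltaD := extD Delta_ext.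
Let DC := ext_center D_ext.
Let DeltaC := ext_center Delta_ext.
Let DRC := ext_closure D_ext.
Let DeltaRC := ext_closure Delta_ext.
Let ZC r : Z r -> C (iota r). Proof. by move/(center_iota Q_sym). Qed.

Lemma image_center : ZL <-> forall z, L z -> C (Delta (D (iota z))).
Proof.
split=> [dZ z Lz|dZ _ [z Lz <-]].
  by rewrite (ext_iota D_ext) (ext_iota Delta_ext); apply/ZC/dZ; exists z.
by apply/(center_iota Q_sym); rewrite -(ext_iota Delta_ext) -(ext_iota D_ext); apply: dZ.
Qed.

Lemma polarize r z : ZL -> L z -> (forall s, Z s -> L (s ** z)) -> Z r ->
  C (Delta (D (iota r)) * iota z + D (iota r) * Delta (iota z) + Delta (iota r) * D (iota z)).
Proof.
move=> /image_center dZ Lz LZz Zr; have := dZ _ (LZz _ Zr).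
rewrite iM DM DeltaD !DeltaM => Crz.
have Cz := centerM (ZC Zr) (dZ _ Lz).
have := centerD Crz (centerN Cz); set u := iota r * _; set v := Delta (iota r) * _.
set w := D _ * _; set t := _ * iota z.
by rewrite -[u + v + _]addrA [u + _]addrC addrK addrC [w + t]addrC.
Qed.

(** An inner [d] kills [C], so [polarize] at an [r] moved by [delta] leaves [delta(r) [g, z]] in
    [C], which forces the trace of [g] to vanish. *)
Lemma inner_outer_iff : X_inner iota d -> X_outer iota delta ->
  ZL <-> d @` RR `<=` Z.
Proof.
move=> /(X_inner_ad D_ext) D_in /(X_outer_center Delta_ext)[r Zr dr0].
have [g RCg DE] := D_in; rewrite (image_commset_center D_ext RCg DE).
have DC0 c : C c -> D c = 0 by apply: inner_derivation_center.
split=> [dZ|Tg]; last first.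
  apply/image_center => z Lz; rewrite DE; last exact: closure_iota.
  by apply: DeltaC; apply: ad_trace0 => //; [apply: closure_iota | apply: lie_trace0].
have [z [Lz nCz LZz]] := lie_scalable; apply: (trace0_detect Lz nCz RCg).
have := polarize dZ Lz LZz Zr; rewrite DC0; last exact: ZC.
rewrite (derivation0 (proj1 Delta_ext)) !mul0r !add0r (ext_iota Delta_ext) DE.
  2: exact: closure_iota.
apply: (center_divl center_inv).
  by rewrite -(ext_iota Delta_ext); apply/DeltaC/ZC.
by rewrite -(raddf0 iota) => /(sq_inj Q_sym).
Qed.

(** Modulo [C], [[g, z]] is [t z] with [t] the trace of [g]. So [delta d (z) = t [e, z]], and its
    centrality means that [t = 0] or [e] has trace zero. *)
Lemma inner_inner_iff : X_inner iota d -> X_inner iota delta ->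
  ZL <-> d @` RR `<=` Z \/ delta @` RR `<=` Z.
Proof.
move=> /(X_inner_ad D_ext)[g RCg DE] /(X_inner_ad Delta_ext)[e RCe DeltaE].
rewrite (image_commset_center D_ext RCg DE) (image_commset_center Delta_ext RCe DeltaE).
rewrite image_center; split=> [dZ|T0 z Lz]; last first.
  have RCz : RC (iota z) := closure_iota z; have Tz := lie_trace0 Lz.
  have RCgz := A_ad F RCg RCz; rewrite DE // DeltaE //.
  case: T0 => T0; first by rewrite ad_centerr; [apply: center0 | apply: ad_trace0].
  by apply: ad_trace0 => //; apply: (has_trace_ad F).
have [z [Lz nCz _]] := lie_scalable; have RCz : RC (iota z) := closure_iota z.
have [t Tgt] := trace_exists F RCg; have [Ct _] := Tgt.
have Cgz := ad_trace F RCg RCz Tgt (lie_trace0 Lz).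
have := dZ z Lz; rewrite DE // DeltaE; last exact: (A_ad F).
rewrite -[ad g _](subrK (t * iota z)) adDr ad_centerr // add0r adZr // => Ctez.
have [t0|/eqP tn0] := eqVneq t 0; first by left; rewrite -t0.
by right; apply: (trace0_detect Lz nCz RCe); apply: center_divl Ctez.
Qed.

(** Now [delta] kills [C], and [polarize] leaves [d(r) [e, z]] in [C]. Conversely [d z] again has
    trace zero, so [[e, d z]] is central. *)
Lemma outer_inner_iff : X_outer iota d -> X_inner iota delta ->
  ZL <-> delta @` RR `<=` Z.
Proof.
move=> /(X_outer_center D_ext)[r Zr dr0] /(X_inner_ad Delta_ext) Delta_in.
have [e RCe DeltaE] := Delta_in; rewrite (image_commset_center Delta_ext RCe DeltaE).
have DeltaC0 c : C c -> Delta c = 0 by apply: (inner_derivation_center Delta_in).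
split=> [dZ|Te]; last first.
  apply/image_center => z Lz; have RCz : RC (iota z) := closure_iota z.
  rewrite DeltaE; last exact: DRC.
  by apply: ad_trace0 => //; [apply: DRC | apply: (ext_trace0 D_ext) => //; apply: lie_trace0].
have [z [Lz nCz LZz]] := lie_scalable; apply: (trace0_detect Lz nCz RCe).
have := polarize dZ Lz LZz Zr; rewrite (DeltaC0 _ (DC (ZC Zr))) (DeltaC0 _ (ZC Zr)).
rewrite !mul0r addr0 add0r (ext_iota D_ext) DeltaE; last exact: closure_iota.
apply: (center_divl center_inv).
  by rewrite -(ext_iota D_ext); apply/DC/ZC.
by rewrite -(raddf0 iota) => /(sq_inj Q_sym).
Qed.

Lemma outer_outer_sufficient r (g mu h : Q) : Z r -> d r <> 0 -> C mu -> RC g ->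
  commset RC RC h ->
  (forall x, RC x -> iota (delta r) * D x + iota (d r) * Delta x = ad g x) ->
  (forall x, RC x -> D (D x) = mu * D x + ad h x) ->
  (forall x, LC x -> C (iota (delta r) * mu * x + ad g x)) -> ZL.
Proof.
move=> Zr dr0 Cmu RCg /(commset_has_trace0 F)[RCh Th] gE hE CLC.
have Cdr : C (iota (d r)) by rewrite -(ext_iota D_ext); apply/DC/ZC.
have Cder : C (iota (delta r)) by rewrite -(ext_iota Delta_ext); apply/DeltaC/ZC.
have idr0 : iota (d r) <> 0 by rewrite -(raddf0 iota) => /(sq_inj Q_sym).
(* The condition on [LC], taken at [a0], is the definition of this trace. *)
have Tg : trace g (iota (delta r) * mu).
  split; first exact: centerM.
  by rewrite (adC char2) (opp_char2 char2) addrC; apply: CLC; apply: cspan_iota.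
apply/image_center => z Lz; have RCz : RC (iota z) := closure_iota z.
have RCw := DRC RCz; have Tw := ext_trace0 D_ext RCz (lie_trace0 Lz).
apply: (center_divl center_inv Cdr idr0).
have -> : iota (d r) * Delta (D (iota z)) =
    (ad g (D (iota z)) - iota (delta r) * mu * D (iota z)) - iota (delta r) * ad h (iota z).
  rewrite -gE // hE //; move: (ad h _) => v; rewrite mulrDr mulrA [_ + iota (d r) * _]addrC.
  by rewrite -addrA -opprD addrK.
apply/centerD/centerN/centerM => //; first exact: (ad_trace F).
by apply: ad_trace0 => //; apply: lie_trace0.
Qed.

(** Any [r] in [Z(R)] moved by [d] serves as [beta]; [g] and [h] come from two combinations of
    derivations that kill [Z(R)] and are therefore inner. *)
Lemma outer_outer_necessary : X_outer iota delta -> X_outer iota d -> ZL ->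
  exists r, [/\ Z r, d r <> 0, delta r <> 0 &
    exists g mu h : Q,
      [/\ RC g, C mu & commset RC RC h] /\
      [/\ forall x, RC x ->
            iota (delta r) * D x + iota (d r) * Delta x = ad g x,
          forall x, RC x -> D (D x) = mu * D x + ad h x,
          forall x, LC x -> C (iota (delta r) * mu * x + ad g x) &
          LC (g ^+ 2 + iota (delta r) * mu * g)]].
Proof.
move=> /(X_outer_center Delta_ext)[s Zs des0] /(X_outer_center D_ext)[r Zr dr0] dZ.
have [z [Lz nCz LZz]] := lie_scalable; have RCz : RC (iota z) := closure_iota z.
have Tz := lie_trace0 Lz; have addrK2 x y : x + y + y = x by rewrite -addrA char2 addr0.
have CD t : Z t -> C (D (iota t)) by move/ZC/DC.
have CDelta t : Z t -> C (Delta (iota t)) by move/ZC/DeltaC.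
have iota_neq0 t : t <> 0 -> iota t <> 0.
  by move=> tn0; rewrite -(raddf0 iota) => /(sq_inj Q_sym).
have eq2 x y : x + y = 0 -> x = y.
  by move/eqP; rewrite addr_eq0 (opp_char2 char2) => /eqP.
(* Subtracting [u] times [polarize] at [z] from [polarize] at [u z] leaves a central multiple of the
   noncentral [z]. *)
have cross t u : Z t -> Z u -> D (iota t) * Delta (iota u) = Delta (iota t) * D (iota u).
  move=> Zt Zu; apply: eq2.
  apply: (center_scale_noncentral F _ nCz).
    by apply: centerD; apply: centerM; auto.
  have LZuz v : Z v -> L (v ** (u ** z)).
    move=> Zv; have Zuv : Z (v ** u).
      by apply/(center_iota Q_sym); rewrite iM; apply/centerM/ZC/Zu/ZC.
    suff -> : v ** (u ** z) = v ** u ** z by apply: LZz.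
    by rewrite rmulA.
  have := polarize dZ (LZz _ Zu) LZuz Zt; rewrite iM DM DeltaM => P1.
  have := centerD P1 (centerN (centerM (ZC Zu) (polarize dZ Lz LZz Zt))).
  have Cu := ZC Zu; rewrite !mulrDr !(centerCA _ _ Cu) mulrDl -![_ * _ * iota z]mulrA.
  set A1 := iota u * (_ * iota z); set A2 := iota u * (_ * Delta _).
  set A3 := iota u * (_ * D _); set A4 := _ * (_ * iota z); set A5 := _ * (_ * iota z).
  by rewrite (addrA A1) addrACA [A1 + _ + _ + _]addrC addrK.
have idr0 := iota_neq0 _ dr0; have ides0 := iota_neq0 _ des0.
set B := D (iota r); set E0 := Delta (iota r).
have BE : B = iota (d r) := ext_iota D_ext r.
have E0E : E0 = iota (delta r) := ext_iota Delta_ext r.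
have CB : C B := CD _ Zr; have CE0 : C E0 := CDelta _ Zr.
have Bn0 : B <> 0 by rewrite BE.
(* [cross r s] equates the nonzero [D r * Delta s] with [Delta r * D s]. *)
have E0n0 : E0 <> 0.
  move=> E00; apply: ides0; rewrite -(ext_iota Delta_ext).
  by apply: (center_mulI center_inv CB Bn0); rewrite (cross r s) // -/E0 E00 mul0r.
have der0 : delta r <> 0 by move=> e0; apply: E0n0; rewrite E0E e0 raddf0.
pose E x := E0 * D x + B * Delta x.
have E_der : derivation E by apply: derivation_comb => //.
have EC0 : forall c, C c -> E c = 0.
  by apply: derivation_center_eq0 => // t Zt; rewrite /E (cross r t) // char2.
have [|g RCg gE] := derivation_inner F E_der _ EC0.
  move=> x RCx; apply: closureD; apply: (closureM Q_sym).
  - exact: (wf_C F).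
  - exact: DRC.
  - exact: (wf_C F).
  - exact: DeltaRC.
have [k Ck k1] := center_inv CE0 E0n0.
set t0 := Delta B; have Ct0 : C t0 by apply: DeltaC.
(* Chosen so that [E0 mu = t0], which is shown to be the trace of [g]. *)
pose mu := k * t0; have Cmu : C mu by apply: centerM.
have E0mu : E0 * mu = t0 by rewrite /mu mulrA (centerE _ CE0) k1 mul1r.
have Cg : C (ad g (iota z) - t0 * iota z).
  rewrite -gE // (opp_char2 char2) /E addrC [E0 * _ + _]addrC addrA.
  exact: polarize.
have Tg : trace g t0 by apply: (has_trace_detect F RCg RCz Tz nCz).
(* Combining [polarize] at [t] with the trace relation of [g] gives [B Delta (D t) = D t t0]. As [E]
   kills the central [D t], this is also [E0 D (D t)]. *)
have D2Z t : Z t -> D (D (iota t)) = mu * D (iota t).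
  move=> Zt; have CT := CD _ Zt; have CX : C (Delta (D (iota t))) by apply: DeltaC.
  have BX : B * Delta (D (iota t)) = D (iota t) * t0.
    apply: eq2; apply: (center_scale_noncentral F _ nCz).
      by apply: centerD; apply: centerM.
    have := centerD (centerM CB (polarize dZ Lz LZz Zt)) (centerM CT Cg).
    rewrite -gE // /E !mulrDr mulrN (opp_char2 char2) !mulrA mulrDl.
    rewrite (cross r t) // -/E0 (centerE B CT) (centerE E0 CT).
    set A1 := _ * iota z; set A2 := _ * Delta (iota z); set A3 := _ * D (iota z).
    set A4 := _ * iota z; rewrite -(addrA A1) [A3 + A2]addrC [A1 + _]addrC addrACA.
    by rewrite char2 add0r.
  have : E0 * D (D (iota t)) = B * Delta (D (iota t)) by apply: eq2; apply: EC0.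
  rewrite BX => e; rewrite -[LHS]mul1r -k1 -mulrA e.
  by rewrite (centerE _ CT) mulrA.
pose E2 x := 1 * (D \o D) x + (- mu) * D x.
have E2_der : derivation E2.
  apply: derivation_comb; [|by case: D_ext|exact: center1|exact: centerN].
  by apply: derivation_square => //; case: D_ext.
have [||h RCh hE] := derivation_inner F E2_der.
- move=> x RCx; apply: closureD; apply: (closureM Q_sym).
  - by apply: (wf_C F); apply: center1.
  - by apply: (DRC); apply: DRC.
  - by apply: (wf_C F); apply: centerN.
  - exact: DRC.
- apply: derivation_center_eq0 => // t Zt.
  by rewrite /E2 /= D2Z // mul1r mulNr subrr.
have DDE x : RC x -> D (D x) = mu * D x + ad h x.
  by move=> RCx; rewrite -hE // /E2 /= mul1r mulNr addrC subrK.
have RCw := DRC RCz; have Tw := ext_trace0 D_ext RCz Tz.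
(* [E0 [h, z]] is [[g, D z] - t0 D z], central because [D z] has trace zero, minus [B Delta (D z)],
   central by [dZ]. *)
have Th : trace h 0.
  apply: (trace0_detect Lz nCz RCh); apply: (center_divl center_inv CE0 E0n0).
  have -> : E0 * ad h (iota z) =
      (ad g (D (iota z)) - t0 * D (iota z)) - B * Delta (D (iota z)).
    rewrite -gE // /E DDE // -E0mu; move: (ad h _) => v.
    rewrite mulrDr mulrA -[_ + E0 * v + _]addrA [E0 * mu * _ + _]addrC.
    by rewrite addrK addrK.
  apply/centerD/centerN/centerM => //; first exact: (ad_trace F).
  by move/image_center: dZ; apply.
exists r; split=> //; exists g, mu, h; rewrite -E0E -BE E0mu; split.
  by split=> //; apply: (commset_trace0 F).
split=> // [x /cspan_trace0[RCx Tx]|].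
  by rewrite addrC -[t0 * x](opp_char2 char2); apply: (ad_trace F).
by apply: center_cspan; apply: (has_trace_norm F).
Qed.

End TwoDerivations.

End Frame.
End LieIdeal.

Theorem theorem7p3 (R : rngType) (Q : nzRingType) (iota : {additive R -> Q})
    (R_prime : prime_rng R) (Q_sym : symmetric_quotients iota)
    (R_exc : exceptional iota)
    (delta d : R -> R) (delta_der : derivation delta) (d_der : derivation d)
    (delta_neq0 : exists x, delta x <> 0) (d_neq0 : exists x, d x <> 0)
    (Delta D : Q -> Q)
    (Delta_ext : der_extension iota delta Delta) (D_ext : der_extension iota d D)
    (L : set R) (L_lie : lie_ideal L) (L_abelian : lie_abelian L)
    (L_noncentral : noncentral L) :
  let Z := rng_center R in
  let C := ext_centroid Q in
  let RC := central_closure iota in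
  let LC := cspan iota L in
  let RR := commset [set: R] [set: R] in
  [/\ X_inner iota d -> X_outer iota delta ->
        ((delta \o d) @` L `<=` Z <-> d @` RR `<=` Z),
      X_inner iota d -> X_inner iota delta ->
        ((delta \o d) @` L `<=` Z <-> d @` RR `<=` Z \/ delta @` RR `<=` Z),
      X_outer iota d -> X_inner iota delta ->
        ((delta \o d) @` L `<=` Z <-> delta @` RR `<=` Z) &
      X_outer iota delta -> X_outer iota d ->
        ((delta \o d) @` L `<=` Z <->
         exists beta : R, [/\ Z beta, d beta <> 0, delta beta <> 0 &
           exists g mu h : Q,
             [/\ RC g, C mu & commset RC RC h] /\
             [/\ forall x, RC x ->
                   iota (delta beta) * D x + iota (d beta) * Delta x = ad g x,
                 forall x, RC x -> D (D x) = mu * D x + ad h x,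
                 forall z, LC z -> C (iota (delta beta) * mu * z + ad g z) &
                 ~ (D @` LC `<=` LC) -> ~ commset RC RC g ->
                   LC (g ^+ 2 + iota (delta beta) * mu * g)]])].
Proof.
move=> Z C RC LC RR.
have [a [b [La F]]] := lie_frame R_prime Q_sym R_exc L_lie L_abelian L_noncentral.
split.
- exact: (inner_outer_iff R_prime Q_sym R_exc L_lie L_abelian La F Delta_ext D_ext).
- exact: (inner_inner_iff R_prime Q_sym R_exc L_lie L_abelian La F Delta_ext D_ext).
- exact: (outer_inner_iff R_prime Q_sym R_exc L_lie L_abelian La F Delta_ext D_ext).
move=> delta_outer d_outer; split=> [dZ|].
  have [r [Zr dr0 der0 [g [mu [h [gmuh [gE hE CLC LCg]]]]]]] :=
    outer_outer_necessary R_prime Q_sym R_exc L_lie L_abelian La F Delta_ext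
      D_ext delta_outer d_outer dZ.
  by exists r; split=> //; exists g, mu, h; split.
move=> [r [Zr dr0 _ [g [mu [h [[RCg Cmu RRh] [gE hE CLC _]]]]]]].
exact: (outer_outer_sufficient R_prime Q_sym R_exc L_abelian La F Delta_ext D_ext
  Zr dr0 Cmu RCg RRh).
Qed.
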